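(* In the Euclidean plane, let ${\rm O},{\rm A},{\rm B}$ be three distinct points. For every $T>0$ there are exactly two simple Keplerian arcs around ${\rm O}$ going from ${\rm A}$ to ${\rm B}$ with elapsed time $T$.
   Context: Kepler problem normalized as $\ddot q=-q/|q|^3$, $q\in\mathbb R^2$, fixed center ${\rm O}$. A Keplerian arc from ${\rm A}$ to ${\rm B}$ is a solution on a compact time interval $[t_{\rm A},t_{\rm B}]$, $t_{\rm A}<t_{\rm B}$, with $q(t_{\rm A})={\rm A}$, $q(t_{\rm B})={\rm B}$; elapsed time $t_{\rm B}-t_{\rm A}$. Rectilinear motions are extended after collision with ${\rm O}$ (bounce back along the same ray with the same energy). An arc is indirect if its convex hull contains ${\rm O}$, direct otherwise. An indirect arc is multi-revolution if the orbit is periodic and the elapsed time exceeds a period. A Keplerian arc is simple if it is not multi-revolution, i.e. it does not pass twice through the same point with the same velocity (direct arcs and simple indirect arcs). *)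

(* Defs.v *)
From Stdlib Require Import Reals Lra List.
Open Scope R_scope.

Definition pt := (R * R)%type.

Definition padd (p q : pt) : pt := (fst p + fst q, snd p + snd q).
Definition psub (p q : pt) : pt := (fst p - fst q, snd p - snd q).
Definition pscal (a : R) (p : pt) : pt := (a * fst p, a * snd p).
Definition pnorm (p : pt) : R := sqrt (fst p ^ 2 + snd p ^ 2).

Definition in_I (tA tB t : R) : Prop := tA <= t <= tB.

Definition kepler_regular (O : pt) (q : R -> pt) (tA tB : R) : Prop :=
  exists v : R -> pt,
    forall t, in_I tA tB t ->
      q t <> O /\
      derivable_pt_lim (fun s => fst (q s)) t (fst (v t)) /\
      derivable_pt_lim (fun s => snd (q s)) t (snd (v t)) /\
      derivable_pt_lim (fun s => fst (v s)) t
        (- (fst (q t) - fst O) / (pnorm (psub (q t) O)) ^ 3) /\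
      derivable_pt_lim (fun s => snd (v s)) t
        (- (snd (q t) - snd O) / (pnorm (psub (q t) O)) ^ 3).

(* Rectilinear motion extended through collisions with O: q = O + r u along a
   fixed ray (unit vector u), r >= 0 continuous, finitely many collision
   instants, and between collisions r'' = -1/r^2 with one and the same energy
   E = r'^2/2 - 1/r (bounce back along the same ray with the same energy). *)
Definition kepler_rectilinear (O : pt) (q : R -> pt) (tA tB : R) : Prop :=
  exists (u : pt) (r w : R -> R) (E : R) (Z : list R),
    pnorm u = 1 /\
    forall t, in_I tA tB t ->
      q t = padd O (pscal (r t) u) /\
      0 <= r t /\
      continuity_pt r t /\
      (r t = 0 -> In t Z) /\
      (0 < r t ->
         derivable_pt_lim r t (w t) /\
         derivable_pt_lim w t (- 1 / (r t) ^ 2) /\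
         (w t) ^ 2 / 2 - 1 / r t = E).

Definition kepler_arc (O A B : pt) (q : R -> pt) (tA tB : R) : Prop :=
  tA < tB /\ q tA = A /\ q tB = B /\
  (kepler_regular O q tA tB \/ kepler_rectilinear O q tA tB).

Definition in_conv_hull (S : pt -> Prop) (p : pt) : Prop :=
  exists l : list (R * pt),
    Forall (fun wx => 0 <= fst wx /\ S (snd wx)) l /\
    fold_right (fun wx acc => fst wx + acc) 0 l = 1 /\
    fold_right (fun wx acc => padd (pscal (fst wx) (snd wx)) acc) (0, 0) l = p.

Definition arc_image (q : R -> pt) (tA tB : R) (x : pt) : Prop :=
  exists t, in_I tA tB t /\ q t = x.

Definition indirect (O : pt) (q : R -> pt) (tA tB : R) : Prop :=
  in_conv_hull (arc_image q tA tB) O.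

Definition multi_revolution (O : pt) (q : R -> pt) (tA tB : R) : Prop :=
  indirect O q tA tB /\
  exists P, 0 < P < tB - tA /\
    forall t, tA <= t <= tB - P -> q (t + P) = q t.

Definition simple_arc (O : pt) (q : R -> pt) (tA tB : R) : Prop :=
  ~ multi_revolution O q tA tB.

Definition simple_kepler_arc (O A B : pt) (q : R -> pt) (tA tB : R) : Prop :=
  kepler_arc O A B q tA tB /\ simple_arc O q tA tB.

Definition same_arc (q1 q2 : R -> pt) (tA tB : R) : Prop :=
  forall t, in_I tA tB t -> q1 t = q2 t.

(* Main.v *)
Require Import Defs.
From Stdlib Require Import Reals Lra List Classical ClassicalEpsilon Ranalysis5.
From Coquelicot Require Import Coquelicot.
Open Scope R_scope.

(** Levi-Civita regularization: writing the position as a complex square [q = z^2] and using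
    the Sundman time [ds = dt / |q|], a Kepler motion of energy [2 k] becomes a solution of
    the linear equation [z'' = k z] with [2 |z'|^2 - 2 k |z|^2 = 1], and collisions become
    regular points.  An arc from [A = a^2] to [B = b^2] lifts to a path from [a] to [b] or
    from [a] to [-b]; each choice gives exactly one simple arc.  Indeed, with
    [m = |a|^2 + |b|^2], [p = <a, b>], and [C], [S], [J] the solutions of [C' = k S],
    [S' = C], [J' = S^2] with [C(0) = 1], [S(0) = J(0) = 0], a lifted path of Sundman length
    [x] and elapsed time [T] exists if and only if [S^2 = 2 (m - 2 p C)] and
    [T = p S + J / 2] at [x].  Along the curve cut out by the first equation, [T] is strictly
    monotone and takes every positive value once before the first zero of [S], which is
    exactly where the arc stops being simple. *)

(** * The solutions of z'' = k z *)

(** The hypothesis [A <> B] enters as [- m < 2 * p < m], because [m - 2 p] and [m + 2 p] are the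
    squared distances from [a] to [b] and to [- b]. Passing from [b] to [- b] only flips the sign of
    [p], so one study of the two equations serves both arcs. These equations are homogeneous: for
    [k = e w^2] with [e = 1] or [e = -1], the first one determines [w] from [y = w x], and the time
    becomes a function of [y] alone. The two branches meet at [y = 0], where the value is the
    parabolic time; hyperbolic arcs are faster, elliptic ones slower. Monotonicity is delicate only
    for [p < 0], when the two terms of the time compete. Lifting a given motion through a collision
    would require a continuous choice of square root of [q]. This is avoided: in Sundman time [q]
    itself satisfies the linear equation [q''' = 4 k q'], whose data [q], [q'], [q''] stay
    continuous at collisions, so that [q] can be compared with [z^2] by a Gronwall estimate which
    tolerates finitely many exceptional instants. *)

Ltac rew_derive H :=
  match type of H with
  | is_derive ?f ?x ?l =>
      replace (Derive (fun y => f y) x) with l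
        by (symmetry; apply is_derive_unique; exact H)
  end.

Definition kC (k s : R) : R :=
  if Rlt_dec k 0 then cos (sqrt (- k) * s)
  else if Rlt_dec 0 k then cosh (sqrt k * s) else 1.

Definition kS (k s : R) : R :=
  if Rlt_dec k 0 then sin (sqrt (- k) * s) / sqrt (- k)
  else if Rlt_dec 0 k then sinh (sqrt k * s) / sqrt k else s.

(* The primitive of [kS k ^ 2] vanishing at [0]. *)
Definition kJ (k s : R) : R :=
  if Req_EM_T k 0 then s ^ 3 / 3 else (kC k s * kS k s - s) / (2 * k).

Lemma kC_derive (k s : R) : is_derive (kC k) s (k * kS k s).
Proof.
  unfold kC, kS.
  destruct (Rlt_dec k 0) as [h|h].
  - assert (h1 : 0 < sqrt (- k)) by (apply sqrt_lt_R0; lra).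
    assert (h2 : sqrt (- k) * sqrt (- k) = - k) by (apply sqrt_sqrt; lra).
    auto_derive; [easy|].
    revert h1 h2; generalize (sqrt (- k)); intros w h1 h2.
    replace k with (- (w * w)) by lra.
    field; lra.
  - destruct (Rlt_dec 0 k) as [h0|h0].
    + assert (h1 : 0 < sqrt k) by (apply sqrt_lt_R0; lra).
      assert (h2 : sqrt k * sqrt k = k) by (apply sqrt_sqrt; lra).
      unfold cosh, sinh; auto_derive; [easy|].
      revert h1 h2; generalize (sqrt k); intros w h1 h2.
      replace k with (w * w) by lra.
      field; lra.
    + replace k with 0 by lra. auto_derive; [easy|ring].
Qed.

Lemma kS_derive (k s : R) : is_derive (kS k) s (kC k s).
Proof.
  unfold kC, kS.
  destruct (Rlt_dec k 0) as [h|h].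
  - assert (h1 : 0 < sqrt (- k)) by (apply sqrt_lt_R0; lra).
    auto_derive; [easy|]. field; lra.
  - destruct (Rlt_dec 0 k) as [h0|h0].
    + assert (h1 : 0 < sqrt k) by (apply sqrt_lt_R0; lra).
      unfold cosh, sinh; auto_derive; [easy|]. field; lra.
    + auto_derive; [easy|ring].
Qed.

Lemma kCS_unit (k s : R) : kC k s ^ 2 - k * kS k s ^ 2 = 1.
Proof.
  unfold kC, kS.
  destruct (Rlt_dec k 0) as [h|h].
  - assert (h1 : 0 < sqrt (- k)) by (apply sqrt_lt_R0; lra).
    assert (h2 : sqrt (- k) * sqrt (- k) = - k) by (apply sqrt_sqrt; lra).
    revert h1 h2; generalize (sqrt (- k)); intros w h1 h2.
    replace k with (- (w * w)) by lra.
    generalize (sin2_cos2 (w * s)); unfold Rsqr; intros e.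
    rewrite <- e. field; lra.
  - destruct (Rlt_dec 0 k) as [h0|h0].
    + assert (h1 : 0 < sqrt k) by (apply sqrt_lt_R0; lra).
      assert (h2 : sqrt k * sqrt k = k) by (apply sqrt_sqrt; lra).
      revert h1 h2; generalize (sqrt k); intros w h1 h2.
      replace k with (w * w) by lra.
      unfold cosh, sinh. rewrite exp_Ropp.
      pose proof (exp_pos (w * s)).
      field; lra.
    + replace k with 0 by lra. ring.
Qed.

Lemma kC_0 (k : R) : kC k 0 = 1.
Proof.
  unfold kC.
  destruct (Rlt_dec k 0); [rewrite Rmult_0_r; apply cos_0|].
  destruct (Rlt_dec 0 k); [rewrite Rmult_0_r; apply cosh_0|easy].
Qed.

Lemma kS_0 (k : R) : kS k 0 = 0.
Proof.
  unfold kS.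
  destruct (Rlt_dec k 0); [rewrite Rmult_0_r, sin_0; unfold Rdiv; ring|].
  destruct (Rlt_dec 0 k); [rewrite Rmult_0_r, sinh_0; unfold Rdiv; ring|easy].
Qed.

Lemma kJ_0 (k : R) : kJ k 0 = 0.
Proof.
  unfold kJ. destruct (Req_EM_T k 0); [field|].
  rewrite kS_0. field; easy.
Qed.

(** The derivative of [C S] is [C^2 + k S^2 = 1 + 2 k S^2]. In this form, without division by [k],
    the relation includes the parabolic case. *)
Lemma kJ_relation (k s : R) : s + 2 * k * kJ k s = kC k s * kS k s.
Proof.
  unfold kJ. destruct (Req_EM_T k 0) as [->|h]; [|field; easy].
  unfold kC, kS. destruct (Rlt_dec 0 0); [lra|]. field.
Qed.

Lemma kJ_derive (k s : R) : is_derive (kJ k) s (kS k s ^ 2).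
Proof.
  unfold kJ. destruct (Req_EM_T k 0) as [->|h].
  - assert (e : kS 0 s = s) by (unfold kS; destruct (Rlt_dec 0 0); lra).
    rewrite e. auto_derive; [easy|field].
  - pose proof (kC_derive k s) as hC. pose proof (kS_derive k s) as hS.
    auto_derive; [repeat split; eexists; eassumption|].
    rew_derive hC; rew_derive hS.
    transitivity ((k * kS k s * kS k s + kC k s ^ 2 - 1) / (2 * k)); [field; easy|].
    replace (kC k s ^ 2) with (1 + k * kS k s ^ 2) by (rewrite <- (kCS_unit k s); ring).
    field; easy.
Qed.

Lemma cosh_plus (x y : R) : cosh (x + y) = cosh x * cosh y + sinh x * sinh y.
Proof.
  unfold cosh, sinh. rewrite Ropp_plus_distr, !exp_plus. field.
Qed.

Lemma sinh_plus (x y : R) : sinh (x + y) = sinh x * cosh y + cosh x * sinh y.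
Proof.
  unfold cosh, sinh. rewrite Ropp_plus_distr, !exp_plus. field.
Qed.

Lemma kC_plus (k s d : R) : kC k (s + d) = kC k s * kC k d + k * kS k s * kS k d.
Proof.
  unfold kC, kS.
  destruct (Rlt_dec k 0) as [h|h].
  - assert (h1 : 0 < sqrt (- k)) by (apply sqrt_lt_R0; lra).
    assert (h2 : sqrt (- k) * sqrt (- k) = - k) by (apply sqrt_sqrt; lra).
    rewrite Rmult_plus_distr_l, cos_plus.
    revert h1 h2; generalize (sqrt (- k)); intros w h1 h2.
    replace k with (- (w * w)) by lra.
    field; lra.
  - destruct (Rlt_dec 0 k) as [h0|h0].
    + assert (h1 : 0 < sqrt k) by (apply sqrt_lt_R0; lra).
      assert (h2 : sqrt k * sqrt k = k) by (apply sqrt_sqrt; lra).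
      rewrite Rmult_plus_distr_l, cosh_plus.
      revert h1 h2; generalize (sqrt k); intros w h1 h2.
      replace k with (w * w) by lra.
      field; lra.
    + replace k with 0 by lra. ring.
Qed.

Lemma kS_plus (k s d : R) : kS k (s + d) = kS k s * kC k d + kC k s * kS k d.
Proof.
  unfold kC, kS.
  destruct (Rlt_dec k 0) as [h|h].
  - assert (h1 : 0 < sqrt (- k)) by (apply sqrt_lt_R0; lra).
    rewrite Rmult_plus_distr_l, sin_plus. field; lra.
  - destruct (Rlt_dec 0 k) as [h0|h0].
    + assert (h1 : 0 < sqrt k) by (apply sqrt_lt_R0; lra).
      rewrite Rmult_plus_distr_l, sinh_plus. field; lra.
    + ring.
Qed.

(** * Lambert's equation *)

(** Differentiability is asked only inside the interval because [lamT] is merely known to be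
    continuous at the origin. *)
Lemma MVT_open (f df : R -> R) (a b : R) :
  a < b ->
  (forall x, a < x < b -> is_derive f x (df x)) ->
  (forall x, a <= x <= b -> continuity_pt f x) ->
  exists c, a < c < b /\ f b - f a = df c * (b - a).
Proof.
  intros hab hd hc.
  assert (pr1 : forall c, a < c < b -> derivable_pt f c).
  { intros c h. exists (df c). apply is_derive_Reals, hd, h. }
  assert (pr2 : forall c, a < c < b -> derivable_pt id c).
  { intros c _. apply derivable_pt_id. }
  destruct (MVT f id a b pr1 pr2 hab hc) as [c [P e]].
  { intros c _. apply derivable_continuous_pt, derivable_pt_id. }
  exists c; split; [easy|].
  rewrite (derive_pt_eq_0 _ _ _ (pr1 c P) (proj1 (is_derive_Reals _ _ _) (hd c P))) in e.
  rewrite (derive_pt_eq_0 _ _ _ (pr2 c P) (derivable_pt_lim_id c)) in e.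
  unfold id in e. lra.
Qed.

Lemma ball_bounds (x y e : R) : ball x e y -> - e < y - x < e.
Proof.
  intros h. apply Rabs_def2 in h. unfold minus, plus, opp in h; simpl in h. lra.
Qed.

Lemma is_derive_continuity_pt (f : R -> R) (x l : R) :
  is_derive f x l -> continuity_pt f x.
Proof.
  intros h. apply derivable_continuous_pt. exists l. now apply is_derive_Reals.
Qed.

(** The inequalities on [kJ] and [lamN] below reduce to this: an expression vanishing at the origin
    is differentiated, once or twice, until its sign is visible. *)
Lemma positive_from_zero (f df : R -> R) (x : R) :
  0 < x -> f 0 = 0 ->
  (forall u, 0 <= u <= x -> is_derive f u (df u)) ->
  (forall u, 0 < u < x -> 0 < df u) ->
  0 < f x.
Proof.
  intros hx h0 hd hp.
  destruct (MVT_open f df 0 x hx) as [c [hc e]].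
  - intros u hu. apply hd. lra.
  - intros u hu. eapply is_derive_continuity_pt, hd, hu.
  - specialize (hp c hc). nra.
Qed.

(* [x] lies before the first positive zero of [kS k]: less than one revolution. *)
Definition early (k x : R) : Prop := 0 < x /\ forall u, 0 < u <= x -> 0 < kS k u.

Lemma early_le (k x y : R) : early k x -> 0 < y <= x -> early k y.
Proof.
  intros [h1 h2] hy. split; [lra|]. intros u hu. apply h2. lra.
Qed.

Lemma early_kS (k x : R) : early k x -> 0 < kS k x.
Proof. intros [h1 h2]. apply h2. lra. Qed.

Lemma Derive_kC (k x : R) : Derive (fun y => kC k y) x = k * kS k x.
Proof. apply is_derive_unique, kC_derive. Qed.

Lemma Derive_kS (k x : R) : Derive (fun y => kS k y) x = kC k x.
Proof. apply is_derive_unique, kS_derive. Qed.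

Lemma Derive_kJ (k x : R) : Derive (fun y => kJ k y) x = kS k x ^ 2.
Proof. apply is_derive_unique, kJ_derive. Qed.

Ltac kderive :=
  auto_derive;
  [ repeat match goal with
    | |- _ /\ _ => split
    | |- True => exact I
    | |- ex_derive (fun x => kC ?k x) ?u => exact (ex_intro _ _ (kC_derive k u))
    | |- ex_derive (fun x => kS ?k x) ?u => exact (ex_intro _ _ (kS_derive k u))
    | |- ex_derive (fun x => kJ ?k x) ?u => exact (ex_intro _ _ (kJ_derive k u))
    end
  | rewrite ?Derive_kC, ?Derive_kS, ?Derive_kJ ].

Lemma kJ_pos (k x : R) : early k x -> 0 < kJ k x.
Proof.
  intros hx. apply (positive_from_zero (kJ k) (fun u => kS k u ^ 2)).
  - apply hx.
  - apply kJ_0.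
  - intros u _. apply kJ_derive.
  - intros u hu. apply pow_lt. apply hx. lra.
Qed.

(** * Inequalities between [kC], [kS] and [kJ] for [k = 1] and [k = -1] *)

Section Lambert_inequalities.

Variable k : R.
Hypothesis hk : k = 1 \/ k = -1.

Let k2 : k * k = 1.
Proof. destruct hk as [-> | ->]; ring. Qed.

(** The factor [k] merges [cosh > 1] and [cos < 1] into one statement. *)
Lemma kC_bounds (x : R) : 0 < kS k x -> 0 < 1 + kC k x /\ 0 < k * (kC k x - 1).
Proof.
  intros hs. pose proof (kCS_unit k x) as u. revert hs u.
  destruct hk as [-> | ->]; intros hs u.
  - assert (hc : 0 < kC 1 x).
    { unfold kC. destruct (Rlt_dec 1 0); [lra|]. destruct (Rlt_dec 0 1); [|lra].
      unfold cosh. pose proof (exp_pos (sqrt 1 * x)). pose proof (exp_pos (- (sqrt 1 * x))). lra. }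
    split; nra.
  - split; nra.
Qed.

Lemma kS_square (x : R) : kS k x ^ 2 = k * (kC k x ^ 2 - 1).
Proof.
  pose proof (kCS_unit k x).
  replace (kC k x ^ 2 - 1) with (k * kS k x ^ 2) by lra.
  rewrite <- Rmult_assoc, k2. ring.
Qed.

(** This measures how [kJ / kS ^ 3] varies: the derivative of that quotient is
    [- k * lamN / (2 * kS ^ 4)]. *)
Definition lamN (x : R) : R := k * (6 * kC k x * kJ k x - 2 * kS k x ^ 3).

Lemma lamN_pos (x : R) : early k x -> 0 < lamN x.
Proof.
  intros hx. apply (positive_from_zero lamN (fun u => 6 * kS k u * kJ k u)).
  - apply hx.
  - unfold lamN. rewrite kJ_0, kS_0. ring.
  - intros u _. unfold lamN. kderive.
    replace (6 * kS k u * kJ k u) with (k * k * (6 * kS k u * kJ k u)) by (rewrite k2; ring).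
    ring.
  - intros u hu. assert (hu' : early k u) by (apply (early_le k x); [easy|lra]).
    pose proof (kJ_pos k u hu'). pose proof (early_kS k u hu'). nra.
Qed.

(** This gives the sign of the mixed coefficient in [lamO_pos]. The derivative of the difference of
    the two sides is [S] times the function of [h], and the derivative of the latter factors as
    [3 k (C - 1) (C + 2)]. *)
Lemma lamN_slope (x : R) : early k x -> 3 * (k * (kC k x - 1)) * kJ k x < 2 * lamN x.
Proof.
  intros hx.
  assert (h : forall y, early k y -> 0 < 9 * kJ k y - 3 * k * kS k y * (kC k y - 1)).
  { intros y hy.
    apply (positive_from_zero (fun y => 9 * kJ k y - 3 * k * kS k y * (kC k y - 1))
      (fun u => 3 * (k * (kC k u - 1)) * (kC k u + 2))).
    - apply hy.
    - rewrite kJ_0, kS_0. ring.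
    - intros u _. kderive.
      transitivity (9 * kS k u ^ 2 - 3 * k * kC k u * (kC k u - 1) - 3 * (k * k) * kS k u ^ 2);
        [ring|].
      rewrite k2, kS_square. ring.
    - intros u hu. assert (hu' : early k u) by (apply (early_le k y); [easy|lra]).
      pose proof (kC_bounds u (early_kS k u hu')). nra. }
  enough (0 < k * ((9 * kC k x + 3) * kJ k x - 4 * kS k x ^ 3)).
  { unfold lamN. lra. }
  apply (positive_from_zero (fun x => k * ((9 * kC k x + 3) * kJ k x - 4 * kS k x ^ 3))
    (fun u => kS k u * (9 * kJ k u - 3 * k * kS k u * (kC k u - 1)))).
  - apply hx.
  - rewrite kJ_0, kS_0. ring.
  - intros u _. kderive.
    replace (9 * kJ k u) with (k * k * (9 * kJ k u)) by (rewrite k2; ring).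
    ring.
  - intros u hu. assert (hu' : early k u) by (apply (early_le k x); [easy|lra]).
    pose proof (early_kS k u hu'). pose proof (h u hu'). nra.
Qed.

(** This gives the sign of the coefficient of [p ^ 2] in [lamO_pos]. After division by [(1 + C) ^ 2]
    and use of [S^2 = k (C^2 - 1)], the derivative collapses to [(C - 1) ^ 2 / (1 + C)]. *)
Lemma kJ_lambert_bound (x : R) : early k x ->
  0 < k * (6 * (1 + kC k x) ^ 2 * kJ k x - (5 + 3 * kC k x) * kS k x ^ 3).
Proof.
  intros hx.
  assert (hc : forall u, 0 <= u <= x -> 0 < 1 + kC k u).
  { intros u hu. destruct (Req_dec u 0) as [->|hu0]; [rewrite kC_0; lra|].
    apply kC_bounds. apply hx. lra. }
  assert (h : 0 < k * (6 * kJ k x) - (5 + 3 * kC k x) * kS k x * (kC k x - 1) / (1 + kC k x)).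
  { apply (positive_from_zero (fun x => k * (6 * kJ k x)
        - (5 + 3 * kC k x) * kS k x * (kC k x - 1) / (1 + kC k x))
      (fun u => (kC k u - 1) ^ 2 / (1 + kC k u))).
    - apply hx.
    - rewrite kJ_0, kS_0, kC_0. field.
    - intros u hu. pose proof (hc u hu) as hcu. kderive; [lra|].
      set (c := kC k u) in *.
      transitivity (k * (kS k u ^ 2) * 6
        - (k * kS k u ^ 2 * 3 * (c - 1) / (1 + c) + (5 + 3 * c) * c * (c - 1) / (1 + c)
           + (5 + 3 * c) * (k * kS k u ^ 2) / (1 + c)
           - (5 + 3 * c) * (k * kS k u ^ 2) * (c - 1) / (1 + c) ^ 2)).
      { field; lra. }
      rewrite kS_square. fold c.
      replace (k * (k * (c ^ 2 - 1))) with (c ^ 2 - 1)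
        by (rewrite <- Rmult_assoc, k2; ring).
      field; lra.
    - intros u hu. assert (hu' : 0 < kS k u) by (apply hx; lra).
      pose proof (kC_bounds u hu') as [h1 h2].
      apply Rdiv_lt_0_compat; [|easy]. nra. }
  pose proof (hc x ltac:(destruct hx; lra)) as h1.
  replace (k * (6 * (1 + kC k x) ^ 2 * kJ k x - (5 + 3 * kC k x) * kS k x ^ 3))
    with ((k * (6 * kJ k x) - (5 + 3 * kC k x) * kS k x * (kC k x - 1) / (1 + kC k x))
          * (1 + kC k x) ^ 2).
  - apply Rmult_lt_0_compat; [easy|]. apply pow_lt; easy.
  - replace (kS k x ^ 3) with (kS k x * kS k x ^ 2) by ring. rewrite kS_square.
    transitivity (k * (6 * (1 + kC k x) ^ 2 * kJ k x)
      - k * k * ((5 + 3 * kC k x) * (kS k x * (kC k x ^ 2 - 1)))); [rewrite k2; field; lra|ring].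
Qed.

End Lambert_inequalities.

(* For [k = 1] or [k = -1], after the rescaling which makes [S = sqrt (lamG k m p x)] solve
   [S^2 = 2 (m - 2 p C)], the elapsed time is [lamT k m p x], and
   [lamO] is [- k * sqrt lamG * dlamT/dx]. *)
Definition lamG (k m p x : R) : R := 2 * m - 4 * p * kC k x.

Definition lamO (k m p x : R) : R :=
  2 * p * kS k x * (p + 3 * lamG k m p x * kJ k x / (2 * kS k x ^ 3))
  + lamG k m p x ^ 2 * lamN k x / (4 * kS k x ^ 4).

(* [J / S^3] extended by its limit [1/3] at the origin. *)
Definition lamJ (k x : R) : R :=
  if Rle_dec x 0 then 1 / 3 else kJ k x / kS k x ^ 3.

Definition lamT (k m p x : R) : R :=
  p * sqrt (lamG k m p x) + sqrt (lamG k m p x) ^ 3 * lamJ k x / 2.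

Section Lambert_time.

Variable k : R.
Hypothesis hk : k = 1 \/ k = -1.

Let k2 : k * k = 1.
Proof. destruct hk as [-> | ->]; ring. Qed.

Lemma lamO_pos (m p x : R) :
  - m < 2 * p < m -> early k x -> 0 < lamG k m p x -> 0 < lamO k m p x.
Proof.
  intros hp hx hG.
  pose proof (early_kS k x hx) as hs.
  pose proof (kJ_pos k x hx) as hJ.
  pose proof (lamN_pos k hk x hx) as hN.
  pose proof (kC_bounds k hk x hs) as [hc1 hc2].
  destruct (Rle_lt_dec 0 p) as [h|h].
  - apply Rplus_le_lt_0_compat.
    + apply Rmult_le_pos; [apply Rmult_le_pos; lra|].
      apply Rplus_le_le_0_compat; [easy|].
      apply Rlt_le, Rdiv_lt_0_compat; [nra|]. pose proof (pow_lt _ 3 hs); lra.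
    + apply Rdiv_lt_0_compat; [|pose proof (pow_lt _ 4 hs); lra].
      apply Rmult_lt_0_compat; [apply pow_lt|]; easy.
  - pose proof (lamN_slope k hk x hx) as i1.
    pose proof (kJ_lambert_bound k hk x hx) as i2.
    pose proof (kS_square k hk x) as q.
    (* [D] is the constant [2 m + 4 p], positive by [- m < 2 * p]. Eliminating [lamG] in favour of
       [D] makes [lamO] a quadratic form in [- p > 0] and [D > 0], and its three coefficients turn
       out to be positive. *)
    set (D := lamG k m p x + 4 * p * (1 + kC k x)).
    assert (hD : 0 < D) by (unfold D, lamG; lra).
    replace (lamG k m p x) with (D - 4 * p * (1 + kC k x)) in * by (unfold D; ring).
    unfold lamO.
    replace (lamG k m p x) with (D - 4 * p * (1 + kC k x)) in * by (unfold D; ring).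
    clearbody D.
    assert (z0 : 0 < 2 * kS k x ^ 5 - 12 * (1 + kC k x) * kJ k x * kS k x ^ 2
                   + 4 * (1 + kC k x) ^ 2 * lamN k x).
    { replace (2 * kS k x ^ 5) with (2 * (kS k x ^ 2 * kS k x ^ 3)) by ring.
      unfold lamN. rewrite q.
      replace (2 * (k * (kC k x ^ 2 - 1) * kS k x ^ 3)
        - 12 * (1 + kC k x) * kJ k x * (k * (kC k x ^ 2 - 1))
        + 4 * (1 + kC k x) ^ 2 * (k * (6 * kC k x * kJ k x - 2 * kS k x ^ 3)))
      with (2 * (1 + kC k x) *
         (k * (6 * (1 + kC k x) ^ 2 * kJ k x - (5 + 3 * kC k x) * kS k x ^ 3))) by ring.
      nra. }
    assert (z1 : 0 < 2 * (1 + kC k x) * lamN k x - 3 * kS k x ^ 2 * kJ k x).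
    { rewrite q.
      replace (2 * (1 + kC k x) * lamN k x - 3 * (k * (kC k x ^ 2 - 1)) * kJ k x)
        with ((1 + kC k x) * (2 * lamN k x - 3 * (k * (kC k x - 1)) * kJ k x)) by ring.
      nra. }
    replace (2 * p * kS k x * (p + 3 * (D - 4 * p * (1 + kC k x)) * kJ k x / (2 * kS k x ^ 3))
      + (D - 4 * p * (1 + kC k x)) ^ 2 * lamN k x / (4 * kS k x ^ 4))
    with ((p ^ 2 * (2 * kS k x ^ 5 - 12 * (1 + kC k x) * kJ k x * kS k x ^ 2
                   + 4 * (1 + kC k x) ^ 2 * lamN k x)
           + (- p) * D * (2 * (1 + kC k x) * lamN k x - 3 * kS k x ^ 2 * kJ k x)
           + D ^ 2 * lamN k x / 4) / kS k x ^ 4) by (field; lra).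
    apply Rdiv_lt_0_compat; [|apply pow_lt; easy].
    assert (0 < p ^ 2) by nra. assert (0 < - p * D) by nra.
    assert (0 < D ^ 2) by nra.
    assert (0 < D ^ 2 * lamN k x) by nra.
    apply Rplus_lt_0_compat; [apply Rplus_lt_0_compat|]; [nra|nra|lra].
Qed.

Lemma lamT_derive (m p x : R) : early k x -> 0 < lamG k m p x ->
  is_derive (lamT k m p) x (- k * lamO k m p x / sqrt (lamG k m p x)).
Proof.
  intros hx hG.
  apply (is_derive_ext_loc (fun x => p * sqrt (lamG k m p x)
    + sqrt (lamG k m p x) ^ 3 * (kJ k x / kS k x ^ 3) / 2)).
  - exists (mkposreal x (proj1 hx)). intros y hy.
    unfold lamT, lamJ. destruct (Rle_dec y 0); [|easy].
    exfalso. apply ball_bounds in hy; simpl in hy. destruct hx. lra.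
  - pose proof (early_kS k x hx) as hs.
    unfold lamG at 1 2. kderive.
    + exact hG.
    + exact hG.
    + pose proof (pow_lt _ 3 hs). simpl in *; lra.
    + change (2 * m + - (4 * p * kC k x)) with (lamG k m p x).
      assert (hg : 0 < sqrt (lamG k m p x)) by (apply sqrt_lt_R0; easy).
      assert (e : sqrt (lamG k m p x) * sqrt (lamG k m p x) = lamG k m p x)
        by (apply sqrt_sqrt; lra).
      unfold lamO, lamN.
      set (g := sqrt (lamG k m p x)) in *. rewrite <- e.
      set (c := kC k x). set (s := kS k x) in *. set (J := kJ k x).
      transitivity (- k * (2 * p * s * (p + 3 * (g * g) * J / (2 * s ^ 3))) / g
        - (k * k) * (g * g) ^ 2 * (6 * c * J - 2 * s ^ 3) / (4 * s ^ 4) / g).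
      * rewrite k2. field. lra.
      * field. lra.
Qed.

Lemma early_of_kC_pos (x : R) :
  0 < x -> (forall u, 0 <= u <= x -> 0 < kC k u) -> early k x.
Proof.
  intros hx hc. split; [easy|]. intros y hy.
  apply (positive_from_zero (kS k) (kC k)).
  - lra.
  - apply kS_0.
  - intros u _. apply kS_derive.
  - intros u hu. apply hc. lra.
Qed.

(** The quotient lies between [1 / 3] and [1 / (3 * kC)], in an order that depends on the sign of
    [k]. Both bounds agree at the origin, which gives continuity there without any series
    expansion. *)
Lemma lamJ_near (x : R) :
  0 < x -> (forall u, 0 <= u <= x -> 0 < kC k u) ->
  Rabs (kJ k x / kS k x ^ 3 - 1 / 3) <= Rabs (1 / (3 * kC k x) - 1 / 3).
Proof.
  intros hx hc. pose proof (early_of_kC_pos x hx hc) as he.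
  pose proof (hc x ltac:(lra)) as hcx.
  pose proof (early_kS k x he) as hs.
  assert (h1 : 0 < k * (kS k x ^ 3 / 3 - kJ k x)).
  { apply (positive_from_zero (fun x => k * (kS k x ^ 3 / 3 - kJ k x))
      (fun u => k * (kC k u - 1) * kS k u ^ 2)).
    - easy.
    - rewrite kS_0, kJ_0. field.
    - intros u _. kderive. field.
    - intros u hu. assert (hu' : 0 < kS k u) by (apply he; lra).
      pose proof (kC_bounds k hk u hu') as [_ hh]. apply Rmult_lt_0_compat; [easy|]. apply pow_lt; easy. }
  assert (h2 : 0 < k * (kJ k x - kS k x ^ 3 / (3 * kC k x))).
  { apply (positive_from_zero (fun x => k * (kJ k x - kS k x ^ 3 / (3 * kC k x)))
      (fun u => k * k * (kS k u ^ 4 / (3 * kC k u ^ 2)))).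
    - easy.
    - rewrite kS_0, kJ_0, kC_0. field.
    - intros u hu. pose proof (hc u hu). kderive; [lra|]. field. lra.
    - intros u hu. assert (hu' : 0 < kS k u) by (apply he; lra).
      rewrite k2, Rmult_1_l. pose proof (hc u ltac:(lra)).
      apply Rdiv_lt_0_compat; [apply pow_lt; easy|]. pose proof (pow_lt _ 2 H). lra. }
  pose proof (pow_lt _ 3 hs) as hs3.
  replace (kJ k x) with ((kJ k x / kS k x ^ 3) * kS k x ^ 3) in h1, h2 by (field; lra).
  set (j := kJ k x / kS k x ^ 3) in *.
  replace (k * (kS k x ^ 3 / 3 - j * kS k x ^ 3)) with (k * (1 / 3 - j) * kS k x ^ 3) in h1 by field.
  replace (k * (j * kS k x ^ 3 - kS k x ^ 3 / (3 * kC k x)))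
    with (k * (j - 1 / (3 * kC k x)) * kS k x ^ 3) in h2 by (field; lra).
  assert (h1' : 0 < k * (1 / 3 - j)) by nra.
  assert (h2' : 0 < k * (j - 1 / (3 * kC k x))) by nra.
  clear h1 h2. destruct hk as [e | e]; rewrite e in h1', h2' |- *.
  - rewrite (Rabs_left (j - 1 / 3)) by lra. rewrite Rabs_left by lra. lra.
  - rewrite (Rabs_right (j - 1 / 3)) by lra. rewrite Rabs_right by lra. lra.
Qed.

Lemma lamJ_continuous_0 : continuity_pt (lamJ k) 0.
Proof.
  assert (c1 : continuity_pt (kC k) 0) by (eapply is_derive_continuity_pt, kC_derive).
  assert (c2 : continuity_pt (fun x => 1 / (3 * kC k x)) 0).
  { eapply is_derive_continuity_pt. kderive. rewrite kC_0; lra. reflexivity. }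
  intros eps heps.
  destruct (c1 (1 / 2) ltac:(lra)) as [d1 [hd1 h1]].
  destruct (c2 eps heps) as [d2 [hd2 h2]].
  exists (Rmin d1 d2). split; [apply Rmin_pos; easy|].
  intros x [_ hx]. simpl in *. unfold R_dist in *.
  rewrite Rminus_0_r in hx.
  unfold lamJ. destruct (Rle_dec 0 0); [|lra].
  destruct (Rle_dec x 0) as [h|h]; [rewrite Rminus_diag, Rabs_R0; easy|].
  apply Rnot_le_lt in h. rewrite Rabs_right in hx by lra.
  pose proof (Rmin_l d1 d2). pose proof (Rmin_r d1 d2).
  apply Rle_lt_trans with (Rabs (1 / (3 * kC k x) - 1 / 3)).
  - apply lamJ_near; [easy|]. intros u hu.
    destruct (Req_dec u 0) as [->|h0]; [rewrite kC_0; lra|].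
    specialize (h1 u). rewrite kC_0, Rminus_0_r in h1.
    assert (hh : Rabs (kC k u - 1) < 1 / 2).
    { apply h1. split; [split; [exact I|lra]|]. rewrite Rabs_right; lra. }
    apply Rabs_def2 in hh. lra.
  - specialize (h2 x). rewrite kC_0, Rminus_0_r, Rmult_1_r in h2.
    apply h2. split; [split; [exact I|lra]|]. rewrite Rabs_right; lra.
Qed.

Lemma sqrt_lamG_continuous (m p x : R) : continuity_pt (fun x => sqrt (lamG k m p x)) x.
Proof.
  apply (continuity_pt_comp (lamG k m p) sqrt).
  - eapply is_derive_continuity_pt. unfold lamG. kderive. reflexivity.
  - apply continuity_pt_filterlim. apply continuous_sqrt.
Qed.

Lemma lamT_continuous (m p x : R) : x = 0 \/ early k x -> continuity_pt (lamT k m p) x.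
Proof.
  intros hx.
  assert (hJ : continuity_pt (lamJ k) x).
  { destruct hx as [->|hx]; [apply lamJ_continuous_0|].
    pose proof (early_kS k x hx) as hs.
    apply (is_derive_continuity_pt _ _ (Derive (fun x => kJ k x / kS k x ^ 3) x)).
    apply (is_derive_ext_loc (fun x => kJ k x / kS k x ^ 3)).
    - exists (mkposreal x (proj1 hx)). intros y hy.
      unfold lamJ. destruct (Rle_dec y 0); [|easy].
      exfalso. apply ball_bounds in hy; simpl in hy. destruct hx. lra.
    - apply Derive_correct. eexists. kderive.
      + pose proof (pow_lt _ 3 hs). simpl in *; lra.
      + reflexivity. }
  pose proof (sqrt_lamG_continuous m p x) as hg.
  unfold lamT.
  apply (continuity_pt_plus (fun x => p * sqrt (lamG k m p x))
    (fun x => sqrt (lamG k m p x) ^ 3 * lamJ k x / 2)).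
  - apply (continuity_pt_mult (fun _ => p) (fun x => sqrt (lamG k m p x))); [|easy].
    now apply continuity_pt_const.
  - apply (continuity_pt_ext (fun x => sqrt (lamG k m p x) * (sqrt (lamG k m p x)
       * sqrt (lamG k m p x)) * lamJ k x * / 2)).
    { intros y. simpl. field. }
    assert (hc : continuity_pt (fun _ => / 2) x) by now apply continuity_pt_const.
    exact (continuity_pt_mult _ _ _
      (continuity_pt_mult _ _ _
        (continuity_pt_mult _ _ _ hg (continuity_pt_mult _ _ _ hg hg)) hJ) hc).
Qed.

Lemma lamT_monotone (m p x y : R) :
  - m < 2 * p < m -> 0 <= x < y -> early k y ->
  (forall u, 0 < u < y -> 0 < lamG k m p u) ->
  k * lamT k m p y < k * lamT k m p x.
Proof.
  intros hp hxy hy hG.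
  destruct (MVT_open (lamT k m p) (fun u => - k * lamO k m p u / sqrt (lamG k m p u)) x y)
    as [c [hc e]].
  - lra.
  - intros u hu. apply lamT_derive; [apply (early_le k y); [easy|lra]|apply hG; lra].
  - intros u hu. apply lamT_continuous.
    destruct (Req_dec u 0) as [->|h]; [now left|right]. apply (early_le k y); [easy|lra].
  - assert (hGc : 0 < lamG k m p c) by (apply hG; lra).
    assert (hO : 0 < lamO k m p c)
      by (apply lamO_pos; [easy|apply (early_le k y); [easy|lra]|easy]).
    enough (0 < lamO k m p c / sqrt (lamG k m p c) * (y - x)) as h.
    { assert (e2 : k * (lamT k m p y - lamT k m p x)
        = - (k * k) * (lamO k m p c / sqrt (lamG k m p c) * (y - x))).
      { rewrite e. unfold Rdiv. ring. }
      rewrite k2 in e2. lra. }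
    apply Rmult_lt_0_compat; [|lra].
    apply Rdiv_lt_0_compat; [easy|]. apply sqrt_lt_R0; easy.
Qed.

End Lambert_time.

(** * Reduction to [k = 1] and [k = -1], and uniqueness *)

Definition lambert (m p T k x : R) : Prop :=
  early k x /\ kS k x ^ 2 = 2 * (m - 2 * p * kC k x) /\ T = p * kS k x + kJ k x / 2.

Lemma kC_scale (e w x : R) : e = 1 \/ e = -1 -> 0 < w -> kC (e * w ^ 2) x = kC e (w * x).
Proof.
  intros [->| ->] hw; unfold kC; pose proof (pow_lt _ 2 hw).
  - destruct (Rlt_dec (1 * w ^ 2) 0); [lra|]. destruct (Rlt_dec 0 (1 * w ^ 2)); [|lra].
    destruct (Rlt_dec 1 0); [lra|]. destruct (Rlt_dec 0 1); [|lra].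
    rewrite Rmult_1_l, sqrt_pow2, sqrt_1, Rmult_1_l by lra. easy.
  - destruct (Rlt_dec (-1 * w ^ 2) 0); [|lra]. destruct (Rlt_dec (-1) 0); [|lra].
    replace (- (-1 * w ^ 2)) with (w ^ 2) by ring. replace (- (-1)) with 1 by ring.
    rewrite sqrt_pow2, sqrt_1, Rmult_1_l by lra. easy.
Qed.

Lemma kS_scale (e w x : R) : e = 1 \/ e = -1 -> 0 < w -> kS (e * w ^ 2) x = kS e (w * x) / w.
Proof.
  intros [->| ->] hw; unfold kS; pose proof (pow_lt _ 2 hw).
  - destruct (Rlt_dec (1 * w ^ 2) 0); [lra|]. destruct (Rlt_dec 0 (1 * w ^ 2)); [|lra].
    destruct (Rlt_dec 1 0); [lra|]. destruct (Rlt_dec 0 1); [|lra].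
    rewrite Rmult_1_l, sqrt_pow2, sqrt_1, Rmult_1_l by lra. field. lra.
  - destruct (Rlt_dec (-1 * w ^ 2) 0); [|lra]. destruct (Rlt_dec (-1) 0); [|lra].
    replace (- (-1 * w ^ 2)) with (w ^ 2) by ring. replace (- (-1)) with 1 by ring.
    rewrite sqrt_pow2, sqrt_1, Rmult_1_l by lra. field. lra.
Qed.

Lemma kJ_scale (e w x : R) : e = 1 \/ e = -1 -> 0 < w -> kJ (e * w ^ 2) x = kJ e (w * x) / w ^ 3.
Proof.
  intros he hw. pose proof (pow_lt _ 2 hw).
  assert (e <> 0) by (destruct he; lra).
  unfold kJ. destruct (Req_EM_T (e * w ^ 2) 0); [nra|]. destruct (Req_EM_T e 0); [easy|].
  rewrite kC_scale, kS_scale by easy. field. split; [easy|lra].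
Qed.

Lemma early_scale (e w x : R) : e = 1 \/ e = -1 -> 0 < w ->
  early (e * w ^ 2) x <-> early e (w * x).
Proof.
  intros he hw. split; intros [h1 h2].
  - split; [nra|]. intros u hu.
    specialize (h2 (u / w)). rewrite kS_scale in h2 by easy.
    replace (w * (u / w)) with u in h2 by (field; lra).
    assert (h : 0 < kS e u / w).
    { apply h2. split; [apply Rdiv_lt_0_compat; lra|].
      apply Rmult_le_reg_l with w; [easy|]. replace (w * (u / w)) with u by (field; lra). lra. }
    replace (kS e u) with (kS e u / w * w) by (field; lra). nra.
  - split; [nra|]. intros u hu. rewrite kS_scale by easy.
    apply Rdiv_lt_0_compat; [|easy]. apply h2. nra.
Qed.

(** At [y = w x] the functions for [k] become [kS e y / w] and [kJ e y / w ^ 3]. The first equation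
    then only fixes the scale [w], and substituting this [w] leaves a single equation for [y]. *)
Lemma lambert_scale (m p T e w x : R) : e = 1 \/ e = -1 -> 0 < w ->
  lambert m p T (e * w ^ 2) x <->
  early e (w * x) /\ 0 < lamG e m p (w * x) /\
  w = kS e (w * x) / sqrt (lamG e m p (w * x)) /\ lamT e m p (w * x) = T.
Proof.
  intros he hw. unfold lambert. rewrite early_scale, kS_scale, kC_scale, kJ_scale by easy.
  set (y := w * x).
  enough (forall hy : early e y,
    ((kS e y / w) ^ 2 = 2 * (m - 2 * p * kC e y) /\
     T = p * (kS e y / w) + kJ e y / w ^ 3 / 2) <->
    (0 < lamG e m p y /\ w = kS e y / sqrt (lamG e m p y) /\ lamT e m p y = T)) by tauto.
  intros hy. pose proof (early_kS _ _ hy) as hs.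
  assert (hT : lamT e m p y = p * sqrt (lamG e m p y)
     + sqrt (lamG e m p y) ^ 3 * (kJ e y / kS e y ^ 3) / 2).
  { unfold lamT, lamJ. destruct (Rle_dec y 0); [destruct hy; lra|easy]. }
  rewrite hT. replace (2 * (m - 2 * p * kC e y)) with (lamG e m p y) by (unfold lamG; ring).
  clear hT. split.
  - intros [h1 h2].
    assert (hq : 0 < kS e y / w) by (apply Rdiv_lt_0_compat; lra).
    assert (hG : 0 < lamG e m p y) by (rewrite <- h1; apply pow_lt; easy).
    assert (hg : sqrt (lamG e m p y) = kS e y / w) by (rewrite <- h1; apply sqrt_pow2; lra).
    rewrite hg. split; [easy|]. split; [field; lra|]. rewrite h2. field; lra.
  - intros [hG [h1 h2]].
    assert (hg : 0 < sqrt (lamG e m p y)) by (apply sqrt_lt_R0; easy).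
    assert (h3 : kS e y / w = sqrt (lamG e m p y)).
    { rewrite h1. field. lra. }
    rewrite h3. split; [apply pow2_sqrt; lra|].
    rewrite <- h2. f_equal. f_equal.
    replace (sqrt (lamG e m p y)) with (kS e y / w) by easy. field. lra.
Qed.

Lemma lambert_zero (m p T x : R) : 2 * p < m ->
  lambert m p T 0 x <-> x = sqrt (2 * m - 4 * p) /\ lamT 0 m p 0 = T.
Proof.
  intros hp.
  assert (hS : forall u, kS 0 u = u) by (intros u; unfold kS; destruct (Rlt_dec 0 0); lra).
  assert (hC : forall u, kC 0 u = 1) by (intros u; unfold kC; destruct (Rlt_dec 0 0); lra).
  assert (hJ : kJ 0 x = x ^ 3 / 3) by (unfold kJ; destruct (Req_EM_T 0 0); lra).
  unfold lambert. rewrite hS, hC, hJ.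
  assert (hg : 0 < sqrt (2 * m - 4 * p)) by (apply sqrt_lt_R0; lra).
  assert (h2 : sqrt (2 * m - 4 * p) ^ 2 = 2 * m - 4 * p) by (apply pow2_sqrt; lra).
  unfold lamT, lamJ, lamG. destruct (Rle_dec 0 0); [|lra]. rewrite hC, !Rmult_1_r.
  split.
  - intros [he [h3 h4]].
    assert (h5 : x = sqrt (2 * m - 4 * p)).
    { replace (2 * m - 4 * p) with (x ^ 2) by lra.
      rewrite sqrt_pow2; [easy|]. destruct he; lra. }
    split; [easy|]. rewrite <- h5, h4. field.
  - intros [-> h4]. split; [|split].
    + split; [easy|]. intros u hu. rewrite hS. lra.
    + lra.
    + rewrite <- h4. field.
Qed.

(** The branches for both signs of [k] start at the parabolic time, since [kC k 0 = 1] and the limit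
    [1 / 3] do not depend on [k]. *)
Lemma lamT_origin (k m p : R) : lamT k m p 0 = lamT 0 m p 0.
Proof.
  unfold lamT, lamJ, lamG. rewrite !kC_0. destruct (Rle_dec 0 0); [easy|lra].
Qed.

(** [lamG] is affine in [kC], and [kC e u] lies between [1] and [kC e y], where the values
    [2 m - 4 p] and [lamG e m p y] are both positive. *)
Lemma lamG_pos_before (e m p u y : R) : e = 1 \/ e = -1 -> 2 * p < m ->
  early e y -> 0 < lamG e m p y -> 0 < u < y -> 0 < lamG e m p u.
Proof.
  intros he hp hy hG hu.
  assert (e2 : e * e = 1) by (destruct he as [->| ->]; ring).
  assert (h1 : 0 < e * (kC e u - 1)).
  { apply kC_bounds; [easy|]. apply hy. lra. }
  assert (h2 : 0 < e * (kC e y - kC e u)).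
  { destruct (MVT_open (kC e) (fun u => e * kS e u) u y) as [c [hc eq]].
    - lra.
    - intros v _. apply kC_derive.
    - intros v _. eapply is_derive_continuity_pt, kC_derive.
    - rewrite eq. assert (0 < kS e c) by (apply hy; lra).
      replace (e * (e * kS e c * (y - u))) with (e * e * (kS e c * (y - u))) by ring.
      rewrite e2. nra. }
  unfold lamG in *. revert h1 h2 hG.
  generalize (kC e u) (kC e y). intros c d. destruct he as [->| ->]; intros; nra.
Qed.

Lemma sign_square_decomposition (k : R) :
  k <> 0 -> exists e w, (e = 1 \/ e = -1) /\ 0 < w /\ k = e * w ^ 2.
Proof.
  intros hk. destruct (Rlt_dec k 0) as [h|h].
  - exists (-1), (sqrt (- k)). split; [now right|]. split; [apply sqrt_lt_R0; lra|].
    rewrite pow2_sqrt; lra.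
  - exists 1, (sqrt k). split; [now left|]. split; [apply sqrt_lt_R0; lra|].
    rewrite pow2_sqrt; lra.
Qed.

(** The sign of the energy is read off by comparing [T] with the parabolic time, so two solutions
    with the same [T] lie on the same branch. *)
Lemma lambert_side (m p T e w x : R) : e = 1 \/ e = -1 -> 0 < w ->
  - m < 2 * p < m -> lambert m p T (e * w ^ 2) x -> e * T < e * lamT 0 m p 0.
Proof.
  intros he hw hp h. apply lambert_scale in h; [|easy|easy].
  destruct h as [h1 [h2 [_ <-]]].
  rewrite <- (lamT_origin e).
  apply lamT_monotone; [easy|easy| |easy|].
  - destruct h1. lra.
  - intros u hu. apply (lamG_pos_before _ _ _ _ (w * x)); try easy; lra.
Qed.

Lemma lambert_unique (m p T k1 x1 k2 x2 : R) : - m < 2 * p < m ->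
  lambert m p T k1 x1 -> lambert m p T k2 x2 -> k1 = k2 /\ x1 = x2.
Proof.
  intros hp h1 h2.
  destruct (Req_dec k1 0) as [->|n1]; destruct (Req_dec k2 0) as [->|n2].
  - apply lambert_zero in h1, h2; [|lra|lra]. split; [easy|]. destruct h1, h2; congruence.
  - destruct (sign_square_decomposition k2 n2) as [e [w [he [hw ->]]]].
    apply lambert_side in h2; [|easy|easy|easy].
    apply lambert_zero in h1; [|lra]. destruct h1 as [_ h1]. rewrite h1 in h2. lra.
  - destruct (sign_square_decomposition k1 n1) as [e [w [he [hw ->]]]].
    apply lambert_side in h1; [|easy|easy|easy].
    apply lambert_zero in h2; [|lra]. destruct h2 as [_ h2]. rewrite h2 in h1. lra.
  - destruct (sign_square_decomposition k1 n1) as [e [w [he [hw ->]]]].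
    destruct (sign_square_decomposition k2 n2) as [e' [w' [he' [hw' ->]]]].
    pose proof h1 as s1. pose proof h2 as s2.
    apply lambert_side in s1, s2; try easy.
    assert (e' = e) as -> by (destruct he as [->| ->], he' as [->| ->]; lra).
    apply lambert_scale in h1, h2; try easy.
    destruct h1 as [a1 [b1 [c1 d1]]], h2 as [a2 [b2 [c2 d2]]].
    assert (hx : w * x1 = w' * x2).
    { destruct (Rtotal_order (w * x1) (w' * x2)) as [h|[h|h]]; [|easy|]; exfalso.
      - assert (hm : e * lamT e m p (w' * x2) < e * lamT e m p (w * x1)).
        { apply lamT_monotone; [easy|easy| |easy|].
          - destruct a1. lra.
          - intros u hu. apply (lamG_pos_before _ _ _ _ (w' * x2)); try easy; lra. }
        rewrite d1, d2 in hm. lra.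
      - assert (hm : e * lamT e m p (w * x1) < e * lamT e m p (w' * x2)).
        { apply lamT_monotone; [easy|easy| |easy|].
          - destruct a2. lra.
          - intros u hu. apply (lamG_pos_before _ _ _ _ (w * x1)); try easy; lra. }
        rewrite d1, d2 in hm. lra. }
    rewrite hx in c1. rewrite <- c2 in c1. subst w'.
    split; [easy|]. apply Rmult_eq_reg_l with w; lra.
Qed.

(** * Existence of a solution for every positive time *)

Lemma lambert_of_lamT (m p T e x : R) : e = 1 \/ e = -1 ->
  early e x -> 0 < lamG e m p x -> lamT e m p x = T -> exists k y, lambert m p T k y.
Proof.
  intros he hx hG hT.
  set (w := kS e x / sqrt (lamG e m p x)).
  assert (hw : 0 < w).
  { apply Rdiv_lt_0_compat; [apply early_kS; easy|apply sqrt_lt_R0; easy]. }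
  exists (e * w ^ 2), (x / w).
  apply lambert_scale; [easy|easy|].
  replace (w * (x / w)) with x by (field; lra). easy.
Qed.

Lemma lamT_reach (m p T e y : R) : e = 1 \/ e = -1 -> early e y ->
  0 < T -> e * T < e * lamT 0 m p 0 -> e * lamT e m p y < e * T ->
  exists x, early e x /\ 0 < lamG e m p x /\ lamT e m p x = T.
Proof.
  intros he hy hT h0 h1.
  destruct (IVT_interv (fun x => e * T - e * lamT e m p x) 0 y) as [x [hx hx0]].
  - intros u hu.
    apply (continuity_pt_minus (fun _ => e * T) (fun x => e * lamT e m p x)).
    + now apply continuity_pt_const.
    + apply (continuity_pt_scal (lamT e m p)).
      apply lamT_continuous; [easy|].
      destruct (Req_dec u 0) as [->|h]; [now left|right]. apply (early_le e y); [easy|lra].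
  - apply hy.
  - rewrite lamT_origin. lra.
  - lra.
  - assert (hxT : lamT e m p x = T) by (destruct he as [->| ->]; lra).
    assert (x <> 0) by (intros ->; rewrite lamT_origin in hxT; rewrite hxT in h0; lra).
    exists x. split; [apply (early_le e y); [easy|lra]|]. split; [|easy].
    (* [sqrt] is [0] on negative arguments, so [lamT] stays continuous, equal to [0], wherever
       [lamG] is not positive. A point with [lamT = T > 0] cannot be there, although [y] itself may
       be. *)
    destruct (Rlt_dec 0 (lamG e m p x)) as [h|h]; [easy|exfalso].
    unfold lamT in hxT. rewrite sqrt_neg_0 in hxT by lra. lra.
Qed.

Lemma kS_unit_neg (x : R) : kS (-1) x = sin x.
Proof.
  unfold kS. destruct (Rlt_dec (-1) 0); [|lra]. replace (- (-1)) with 1 by ring.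
  rewrite sqrt_1, Rmult_1_l. field.
Qed.

Lemma kC_unit_neg (x : R) : kC (-1) x = cos x.
Proof.
  unfold kC. destruct (Rlt_dec (-1) 0); [|lra]. replace (- (-1)) with 1 by ring.
  rewrite sqrt_1, Rmult_1_l. easy.
Qed.

Lemma early_unit_neg (x : R) : 0 < x < PI -> early (-1) x.
Proof.
  intros hx. split; [lra|]. intros u hu. rewrite kS_unit_neg. apply sin_gt_0; lra.
Qed.

(** Near [PI] the sine tends to [0] while [kJ] and [lamG] stay away from [0], so the term in
    [kJ / kS ^ 3] diverges. *)
Lemma lamT_unbounded (m p T : R) : - m < 2 * p < m -> 0 < T ->
  exists y, early (-1) y /\ T < lamT (-1) m p y.
Proof.
  intros hp hT.
  (* [A] bounds the first term of [lamT] in absolute value, [b] bounds [lamG] from below, and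
     [B / d] bounds the second term from below at [PI - d]. The choice of [d] makes [B / d] at least
     [T + A + 1]. *)
  set (A := Rabs p * sqrt (4 * m)).
  set (b := 2 * m - 4 * Rabs p).
  assert (hb : 0 < b) by (unfold b, Rabs; destruct (Rcase_abs p); lra).
  set (B := sqrt b ^ 3 / 4).
  assert (hB : 0 < B).
  { unfold B. pose proof (pow_lt _ 3 (sqrt_lt_R0 _ hb)). lra. }
  assert (hA : 0 <= A) by (apply Rmult_le_pos; [apply Rabs_pos|apply sqrt_pos]).
  set (d := Rmin 1 (B / (T + A + 1))).
  assert (hd : 0 < d).
  { apply Rmin_pos; [lra|]. apply Rdiv_lt_0_compat; lra. }
  assert (hd1 : d <= 1) by apply Rmin_l.
  assert (hd2 : (T + A + 1) * d <= B).
  { pose proof (Rmin_r 1 (B / (T + A + 1))) as h. fold d in h.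
    apply Rmult_le_compat_l with (r := T + A + 1) in h; [|lra].
    replace ((T + A + 1) * (B / (T + A + 1))) with B in h by (field; lra). easy. }
  pose proof PI2_3_2 as hPI.
  assert (he : early (-1) (PI - d)) by (apply early_unit_neg; lra).
  exists (PI - d). split; [easy|].
  pose proof (early_kS _ _ he) as hs. pose proof (kJ_relation (-1) (PI - d)) as hr.
  rewrite kC_unit_neg in hr. rewrite kS_unit_neg in hs, hr.
  assert (hc : cos (PI - d) <= 0).
  { rewrite Rtrigo_facts.cos_pi_minus. pose proof (cos_gt_0 d). lra. }
  assert (hsd : sin (PI - d) <= d).
  { rewrite sin_PI_x. apply Rlt_le, sin_lt_x. easy. }
  (* For [k = -1] the relation reads [2 J = x - cos x * sin x], which is at least [x = PI - d]
     because the cosine is not positive here. *)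
  assert (hJ : 1 / 2 <= kJ (-1) (PI - d)) by nra.
  unfold lamT, lamJ. destruct (Rle_dec (PI - d) 0); [lra|].
  rewrite kS_unit_neg.
  assert (hG1 : b <= lamG (-1) m p (PI - d)).
  { unfold b, lamG. rewrite kC_unit_neg. pose proof (COS_bound (PI - d)).
    unfold Rabs; destruct (Rcase_abs p); nra. }
  assert (hG2 : lamG (-1) m p (PI - d) <= 4 * m).
  { unfold lamG. rewrite kC_unit_neg. pose proof (COS_bound (PI - d)). nra. }
  assert (h1 : - A <= p * sqrt (lamG (-1) m p (PI - d))).
  { apply sqrt_le_1_alt in hG2. pose proof (sqrt_pos (lamG (-1) m p (PI - d))).
    unfold A, Rabs; destruct (Rcase_abs p); nra. }
  assert (h2 : B / d <= sqrt (lamG (-1) m p (PI - d)) ^ 3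
                 * (kJ (-1) (PI - d) / sin (PI - d) ^ 3) / 2).
  { unfold B.
    assert (i1 : sqrt b ^ 3 <= sqrt (lamG (-1) m p (PI - d)) ^ 3).
    { apply pow_incr. split; [apply sqrt_pos|]. apply sqrt_le_1_alt; easy. }
    assert (i2 : 1 / 2 / d <= kJ (-1) (PI - d) / sin (PI - d) ^ 3).
    { pose proof (pow_lt _ 3 hs) as hs3.
      assert (hs4 : sin (PI - d) ^ 3 <= d).
      { apply Rle_trans with (d ^ 3); [apply pow_incr; lra|]. nra. }
      unfold Rdiv at 1 3. apply Rmult_le_compat; [lra| |easy|].
      - apply Rlt_le, Rinv_0_lt_compat; easy.
      - apply Rinv_le_contravar; easy. }
    pose proof (pow_lt _ 3 (sqrt_lt_R0 _ hb)).
    assert (0 < 1 / 2 / d) by (apply Rdiv_lt_0_compat; lra).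
    replace (sqrt b ^ 3 / 4 / d) with (sqrt b ^ 3 * (1 / 2 / d) / 2) by (field; lra).
    apply Rmult_le_compat_r; [lra|]. apply Rmult_le_compat; lra. }
  assert (h3 : T + A + 1 <= B / d).
  { apply Rmult_le_reg_r with d; [easy|]. replace (B / d * d) with B by (field; lra). lra. }
  lra.
Qed.

Lemma kC_unit_pos (x : R) : kC 1 x = cosh x.
Proof.
  unfold kC. destruct (Rlt_dec 1 0); [lra|]. destruct (Rlt_dec 0 1); [|lra].
  rewrite sqrt_1, Rmult_1_l. easy.
Qed.

Lemma early_unit_pos (x : R) : 0 < x -> early 1 x.
Proof.
  intros hx. apply early_of_kC_pos; [easy|]. intros u _.
  rewrite kC_unit_pos. unfold cosh. pose proof (exp_pos u). pose proof (exp_pos (- u)). lra.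
Qed.

Lemma lamT_vanishing (m p T : R) : - m < 2 * p < m -> 0 < T ->
  exists y, early 1 y /\ lamT 1 m p y < T.
Proof.
  intros hp hT.
  assert (hcosh : forall X, 0 < X -> X < kC 1 (2 * X)).
  { intros X hX. rewrite kC_unit_pos. unfold cosh.
    pose proof (exp_ineq1 (2 * X) ltac:(lra)). pose proof (exp_pos (- (2 * X))). lra. }
  destruct (Rlt_dec 0 p) as [h|h].
  (* At [2 X] the hyperbolic cosine exceeds [m / (2 * p)]; thus [lamG] is negative, its [sqrt] is
     [0], and so is [lamT]. *)
  - set (X := m / (2 * p)).
    assert (hX : 0 < X) by (apply Rdiv_lt_0_compat; lra).
    exists (2 * X). split; [apply early_unit_pos; lra|].
    unfold lamT. rewrite sqrt_neg_0; [lra|].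
    specialize (hcosh X hX). unfold lamG.
    replace m with (2 * p * X) at 1 by (unfold X; field; lra). nra.
  (* The final estimate is [(g * (m / c)) ^ 2 <= 4 * m ^ 3 / c], which dictates the first summand.
     The added [2] ensures [c ^ 2 <= 2 * s ^ 2]. *)
  - set (X := 4 * m ^ 3 / T ^ 2 + 2).
    pose proof (pow_lt _ 2 hT) as hT2.
    assert (hm : 0 < m ^ 3) by (apply pow_lt; lra).
    assert (hX0 : 0 < 4 * m ^ 3 / T ^ 2) by (apply Rdiv_lt_0_compat; lra).
    assert (hX : 2 < X) by (unfold X; lra).
    set (y := 2 * X). exists y. assert (hy : early 1 y) by (apply early_unit_pos; unfold y; lra).
    split; [easy|].
    specialize (hcosh X ltac:(lra)). fold y in hcosh.
    pose proof (early_kS _ _ hy) as hs. pose proof (kCS_unit 1 y) as hu.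
    pose proof (kJ_relation 1 y) as hr. pose proof (kJ_pos _ _ hy) as hJ.
    assert (hyc : 0 < y * kC 1 y - kS 1 y).
    { apply (positive_from_zero (fun y => y * kC 1 y - kS 1 y) (fun u => u * kS 1 u)).
      - apply hy.
      - rewrite kS_0. ring.
      - intros u _. kderive. ring.
      - intros u hu'. assert (0 < kS 1 u) by (apply hy; lra). nra. }
    unfold lamT, lamJ. destruct (Rle_dec y 0); [destruct hy; lra|].
    assert (hG : 0 <= lamG 1 m p y) by (unfold lamG; nra).
    assert (hG2 : lamG 1 m p y <= 4 * m * kC 1 y) by (unfold lamG; nra).
    pose proof (sqrt_sqrt _ hG) as hg2. pose proof (sqrt_pos (lamG 1 m p y)) as hg.
    assert (hGdef : lamG 1 m p y = 2 * m - 4 * p * kC 1 y) by easy.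
    set (G := lamG 1 m p y) in *. set (g := sqrt G) in *.
    set (c := kC 1 y) in *. set (s := kS 1 y) in *. set (J := kJ 1 y) in *.
    clearbody g G c s J.
    pose proof (pow_lt _ 3 hs) as hs3.
    (* For [p < 0] the two terms of the time grow without bound with opposite signs. The relations
       [g ^ 2 = 2 m - 4 p c] and [y + 2 J = c s] exhibit their cancellation, leaving a contribution
       of [p] that is not positive. *)
    assert (e1 : p * g + g ^ 3 * (J / s ^ 3) / 2 = g / s ^ 3 * (m * J + p * (y * c - s))).
    { replace y with (c * s - 2 * J) by lra.
      replace (g ^ 3) with (g * (g * g)) by ring. rewrite hg2, hGdef.
      replace (p * ((c * s - 2 * J) * c - s)) with (p * (s * (c ^ 2 - 1) - 2 * J * c)) by ring.
      replace (c ^ 2 - 1) with (s ^ 2) by lra. field. lra. }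
    rewrite e1. clear e1.
    assert (e2 : m * J + p * (y * c - s) <= m * (c * s) / 2).
    { assert (p * (y * c - s) <= 0) by nra. assert (2 * J <= c * s) by (destruct hy; lra). nra. }
    assert (e3 : g / s ^ 3 * (m * J + p * (y * c - s)) <= g * (m / c)).
    { apply Rle_trans with (g / s ^ 3 * (m * (c * s) / 2)).
      - apply Rmult_le_compat_l; [|easy]. apply Rdiv_le_0_compat; easy.
      - replace (g / s ^ 3 * (m * (c * s) / 2)) with (g * (m * (c / (2 * s ^ 2)))) by (field; lra).
        apply Rmult_le_compat_l; [easy|]. apply Rmult_le_compat_l; [lra|].
        apply Rmult_le_reg_r with (2 * s ^ 2 * c); [nra|].
        replace (c / (2 * s ^ 2) * (2 * s ^ 2 * c)) with (c ^ 2) by (field; lra).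
        replace (/ c * (2 * s ^ 2 * c)) with (2 * s ^ 2) by (field; lra). nra. }
    apply Rle_lt_trans with (1 := e3).
    apply Rsqr_incrst_0; [|apply Rmult_le_pos; [easy|apply Rdiv_le_0_compat; lra]|lra].
    unfold Rsqr. replace (g * (m / c) * (g * (m / c))) with (g * g * (m ^ 2 / c ^ 2)) by (field; lra).
    rewrite hg2.
    apply Rle_lt_trans with (4 * m * c * (m ^ 2 / c ^ 2)).
    + apply Rmult_le_compat_r; [|easy]. apply Rdiv_le_0_compat; nra.
    + replace (4 * m * c * (m ^ 2 / c ^ 2)) with (4 * m ^ 3 / c) by (field; lra).
      apply Rmult_lt_reg_r with c; [lra|].
      replace (4 * m ^ 3 / c * c) with (4 * m ^ 3 / T ^ 2 * (T * T)) by (field; lra).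
      unfold X in hcosh. nra.
Qed.

Theorem lambert_exists (m p T : R) : - m < 2 * p < m -> 0 < T -> exists k x, lambert m p T k x.
Proof.
  intros hp hT.
  destruct (Rtotal_order T (lamT 0 m p 0)) as [h|[h|h]].
  - destruct (lamT_vanishing m p T hp hT) as [y [hy1 hy2]].
    destruct (lamT_reach m p T 1 y) as [x [h1 [h2 h3]]]; [now left|easy|easy|lra|lra|].
    apply (lambert_of_lamT m p T 1 x); [now left|easy|easy|easy].
  - exists 0, (sqrt (2 * m - 4 * p)). apply lambert_zero; [lra|]. easy.
  - destruct (lamT_unbounded m p T hp hT) as [y [hy1 hy2]].
    destruct (lamT_reach m p T (-1) y) as [x [h1 [h2 h3]]]; [now right|easy|easy|lra|lra|].
    apply (lambert_of_lamT m p T (-1) x); [now right|easy|easy|easy].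
Qed.

(** * The regularized motion *)

Definition zc (k a u s : R) : R := a * kC k s + u * kS k s.
Definition zd (k a u s : R) : R := k * a * kS k s + u * kC k s.

Lemma zc_derive (k a u s : R) : is_derive (zc k a u) s (zd k a u s).
Proof. unfold zc, zd. kderive. ring. Qed.

Lemma zd_derive (k a u s : R) : is_derive (zd k a u) s (k * zc k a u s).
Proof. unfold zc, zd. kderive. ring. Qed.

Lemma zc_0 (k a u : R) : zc k a u 0 = a.
Proof. unfold zc. rewrite kC_0, kS_0. ring. Qed.

Lemma zd_0 (k a u : R) : zd k a u 0 = u.
Proof. unfold zd. rewrite kC_0, kS_0. ring. Qed.

Lemma zc_plus (k a u s d : R) :
  zc k a u (s + d) = zc k a u s * kC k d + zd k a u s * kS k d.
Proof. unfold zc, zd. rewrite kC_plus, kS_plus. ring. Qed.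

Lemma zd_plus (k a u s d : R) :
  zd k a u (s + d) = k * zc k a u s * kS k d + zd k a u s * kC k d.
Proof. unfold zc, zd. rewrite kC_plus, kS_plus. ring. Qed.

Lemma Derive_zc (k a u s : R) : Derive (fun y => zc k a u y) s = zd k a u s.
Proof. apply is_derive_unique, zc_derive. Qed.

Lemma Derive_zd (k a u s : R) : Derive (fun y => zd k a u y) s = k * zc k a u s.
Proof. apply is_derive_unique, zd_derive. Qed.

(** The physical time, that is the integral of [|z|^2] from [0] to [s], expressed with the
    primitives [s + k J], [S^2] and [J] of [C^2], [2 C S] and [S^2]. *)
Definition ztau (k a1 a2 u1 u2 s : R) : R :=
  (a1 ^ 2 + a2 ^ 2) * (s + k * kJ k s) + (a1 * u1 + a2 * u2) * kS k s ^ 2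
  + (u1 ^ 2 + u2 ^ 2) * kJ k s.

Lemma ztau_derive (k a1 a2 u1 u2 s : R) :
  is_derive (ztau k a1 a2 u1 u2) s (zc k a1 u1 s ^ 2 + zc k a2 u2 s ^ 2).
Proof.
  unfold ztau, zc. kderive.
  transitivity ((a1 ^ 2 + a2 ^ 2) * (1 + k * kS k s ^ 2)
    + (a1 * u1 + a2 * u2) * (2 * kS k s * kC k s) + (u1 ^ 2 + u2 ^ 2) * kS k s ^ 2); [ring|].
  rewrite <- (kCS_unit k s) at 1. ring.
Qed.

Lemma ztau_0 (k a1 a2 u1 u2 : R) : ztau k a1 a2 u1 u2 0 = 0.
Proof. unfold ztau. rewrite kS_0, kJ_0. ring. Qed.

Ltac zderive :=
  auto_derive;
  [ repeat match goal with
    | |- _ /\ _ => split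
    | |- True => exact I
    | |- ex_derive (fun x => zc ?k ?a ?u x) ?s => exact (ex_intro _ _ (zc_derive k a u s))
    | |- ex_derive (fun x => zd ?k ?a ?u x) ?s => exact (ex_intro _ _ (zd_derive k a u s))
    end
  | rewrite ?Derive_zc, ?Derive_zd ].

(** As the velocity is [2 z z' / |z|^2], this is [|v|^2 / 2 - 1 / |z|^2 = 2 k] cleared of its
    denominator, and it remains meaningful at a collision. *)
Definition lc_energy (k a1 a2 u1 u2 : R) : Prop :=
  2 * (u1 ^ 2 + u2 ^ 2) - 2 * k * (a1 ^ 2 + a2 ^ 2) = 1.

Lemma lc_energy_flow (k a1 a2 u1 u2 s : R) :
  lc_energy k a1 a2 u1 u2 ->
  lc_energy k (zc k a1 u1 s) (zc k a2 u2 s) (zd k a1 u1 s) (zd k a2 u2 s).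
Proof.
  unfold lc_energy, zc, zd. intros h.
  transitivity ((2 * (u1 ^ 2 + u2 ^ 2) - 2 * k * (a1 ^ 2 + a2 ^ 2))
    * (kC k s ^ 2 - k * kS k s ^ 2)); [ring|].
  rewrite h, kCS_unit. ring.
Qed.

Lemma constant_of_zero_derive (f : R -> R) (a b : R) :
  (forall x, is_derive f x 0) -> f a = f b.
Proof.
  intros h.
  assert (H : forall a b, a < b -> f a = f b).
  { intros x y hxy. destruct (MVT_open f (fun _ => 0) x y hxy) as [c [_ e]].
    - intros u _. apply h.
    - intros u _. eapply is_derive_continuity_pt, h.
    - lra. }
  destruct (Rtotal_order a b) as [l|[->|l]]; [auto|easy|symmetry; auto].
Qed.

(* Reads off the fictitious time [s] from [q . v] and the physical time. *)
Lemma ztau_virial (k a1 a2 u1 u2 s : R) : lc_energy k a1 a2 u1 u2 ->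
  zc k a1 u1 s * zd k a1 u1 s + zc k a2 u2 s * zd k a2 u2 s
    - 2 * k * ztau k a1 a2 u1 u2 s - s / 2 = a1 * u1 + a2 * u2.
Proof.
  intros h.
  transitivity (zc k a1 u1 0 * zd k a1 u1 0 + zc k a2 u2 0 * zd k a2 u2 0
    - 2 * k * ztau k a1 a2 u1 u2 0 - 0 / 2).
  - apply (constant_of_zero_derive (fun s => zc k a1 u1 s * zd k a1 u1 s
      + zc k a2 u2 s * zd k a2 u2 s - 2 * k * ztau k a1 a2 u1 u2 s - s / 2)).
    intros x. pose proof (lc_energy_flow _ _ _ _ _ x h) as hx. unfold lc_energy in hx.
    pose proof (ztau_derive k a1 a2 u1 u2 x) as ht.
    zderive.
    + eexists; exact ht.
    + replace (Derive (fun y => ztau k a1 a2 u1 u2 y) x)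
        with (zc k a1 u1 x ^ 2 + zc k a2 u2 x ^ 2)
        by (symmetry; apply is_derive_unique; exact ht).
      lra.
  - rewrite !zc_0, !zd_0, ztau_0. field.
Qed.

Lemma ztau_le (k a1 a2 u1 u2 s s' : R) : s <= s' ->
  ztau k a1 a2 u1 u2 s <= ztau k a1 a2 u1 u2 s'.
Proof.
  intros [h|h]; [|subst; lra].
  destruct (MVT_open (ztau k a1 a2 u1 u2)
    (fun s => zc k a1 u1 s ^ 2 + zc k a2 u2 s ^ 2) s s' h) as [c [_ e]].
  - intros u _. apply ztau_derive.
  - intros u _. eapply is_derive_continuity_pt, ztau_derive.
  - pose proof (pow2_ge_0 (zc k a1 u1 c)). pose proof (pow2_ge_0 (zc k a2 u2 c)). nra.
Qed.

(** If the time stood still on the interval, [z] would vanish in each of its halves, at the same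
    physical time. At zeros of [z], [ztau_virial] determines the Sundman time from the physical one,
    so these two zeros would coincide. *)
Lemma ztau_lt (k a1 a2 u1 u2 s s' : R) : lc_energy k a1 a2 u1 u2 -> s < s' ->
  ztau k a1 a2 u1 u2 s < ztau k a1 a2 u1 u2 s'.
Proof.
  intros hE h. destruct (Rlt_dec (ztau k a1 a2 u1 u2 s) (ztau k a1 a2 u1 u2 s')) as [l|l];
    [easy|exfalso].
  assert (hz : forall x y, s <= x < y -> y <= s' ->
    exists c, x < c < y /\ zc k a1 u1 c = 0 /\ zc k a2 u2 c = 0).
  { intros x y hxy hy.
    destruct (MVT_open (ztau k a1 a2 u1 u2)
      (fun s => zc k a1 u1 s ^ 2 + zc k a2 u2 s ^ 2) x y) as [c [hc e]].
    - lra.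
    - intros u _. apply ztau_derive.
    - intros u _. eapply is_derive_continuity_pt, ztau_derive.
    - exists c. split; [easy|].
      pose proof (ztau_le k a1 a2 u1 u2 s x ltac:(lra)).
      pose proof (ztau_le k a1 a2 u1 u2 x y ltac:(lra)).
      pose proof (ztau_le k a1 a2 u1 u2 y s' ltac:(lra)).
      assert (zc k a1 u1 c ^ 2 + zc k a2 u2 c ^ 2 = 0).
      { apply Rmult_eq_reg_r with (y - x); lra. }
      split; nra. }
  destruct (hz s ((s + s') / 2)) as [c [hc [z1 z2]]]; [lra|lra|].
  destruct (hz ((s + s') / 2) s') as [d [hd [w1 w2]]]; [lra|lra|].
  pose proof (ztau_virial k a1 a2 u1 u2 c hE) as v1.
  pose proof (ztau_virial k a1 a2 u1 u2 d hE) as v2.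
  pose proof (ztau_le k a1 a2 u1 u2 s c ltac:(lra)).
  pose proof (ztau_le k a1 a2 u1 u2 c d ltac:(lra)).
  pose proof (ztau_le k a1 a2 u1 u2 d s' ltac:(lra)).
  rewrite z1, z2 in v1. rewrite w1, w2 in v2.
  replace (ztau k a1 a2 u1 u2 d) with (ztau k a1 a2 u1 u2 c) in v2 by lra. lra.
Qed.

Lemma ztau_inj (k a1 a2 u1 u2 s s' : R) : lc_energy k a1 a2 u1 u2 ->
  ztau k a1 a2 u1 u2 s = ztau k a1 a2 u1 u2 s' -> s = s'.
Proof.
  intros hE h. destruct (Rtotal_order s s') as [l|[l|l]]; [|easy|];
    apply (ztau_lt k a1 a2 u1 u2) in l; try easy; lra.
Qed.

(** The induction cuts the interval at the head of [Z]; on either side that instant is at most an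
    endpoint, where continuity suffices. *)
Lemma nonincreasing_off_finite (f df : R -> R) (Z : list R) :
  forall a b, a <= b ->
  (forall t, a <= t <= b -> continuity_pt f t) ->
  (forall t, a < t < b -> ~ In t Z -> is_derive f t (df t) /\ df t <= 0) ->
  f b <= f a.
Proof.
  induction Z as [|z Z IH]; intros a b hab hc hd.
  - destruct hab as [hab|e]; [|rewrite e; lra].
    destruct (MVT_open f df a b hab) as [c [h e]].
    + intros x hx. apply hd; [easy|now intros []].
    + easy.
    + pose proof (proj2 (hd c h ltac:(now intros []))). nra.
  - assert (hstep : forall x y, a <= x <= y -> y <= b -> (z <= x \/ y <= z) -> f y <= f x).
    { intros x y hxy hy hz. apply IH; [lra| |].
      - intros t ht. apply hc. lra.
      - intros t ht hn. apply hd; [lra|]. intros [e|i]; [lra|easy]. }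
    destruct (Rle_dec z a) as [h1|h1]; [apply hstep; lra|].
    destruct (Rle_dec b z) as [h2|h2]; [apply hstep; lra|].
    apply Rle_trans with (f z); apply hstep; lra.
Qed.

Lemma constant_off_finite (f : R -> R) (Z : list R) (a b : R) :
  a <= b ->
  (forall t, a <= t <= b -> continuity_pt f t) ->
  (forall t, a < t < b -> ~ In t Z -> is_derive f t 0) ->
  f b = f a.
Proof.
  intros hab hc hd. apply Rle_antisym.
  - apply (nonincreasing_off_finite f (fun _ => 0) Z); [easy|easy|].
    intros t h1 h2. split; [auto|lra].
  - enough (- f b <= - f a) by lra.
    apply (nonincreasing_off_finite (fun t => - f t) (fun _ => 0) Z); [easy| |].
    + intros t ht. apply (continuity_pt_opp f). auto.
    + intros t h1 h2. split; [|lra].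
      replace 0 with (- 0) by ring. apply (is_derive_opp f). auto.
Qed.

Lemma is_derive_compose (f g : R -> R) (x df dg : R) :
  is_derive f (g x) df -> is_derive g x dg -> is_derive (fun t => f (g t)) x (df * dg).
Proof.
  intros hf hg. rewrite Rmult_comm. exact (is_derive_comp f g x df dg hf hg).
Qed.

(** Gronwall's argument with a weight in the Sundman time [s] rather than in [t]: the factor
    [1 / r], unbounded near collisions, then multiplies the whole derivative and does not affect its
    sign. *)
Lemma regularized_uniqueness (X D W r s Q Qd Qdd : R -> R) (E ta tb : R) (Z : list R) :
  (forall t, ta <= t <= tb ->
    continuity_pt X t /\ continuity_pt D t /\ continuity_pt W t /\ continuity_pt s t) ->
  (forall t, ta <= t <= tb -> ~ In t Z -> 0 < r t /\
    is_derive X t (D t / r t) /\ is_derive D t (W t / r t) /\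
    is_derive W t (2 * E * D t / r t) /\ is_derive s t (1 / r t)) ->
  (forall x, is_derive Q x (Qd x) /\ is_derive Qd x (Qdd x) /\
    is_derive Qdd x (2 * E * Qd x)) ->
  X ta = Q (s ta) -> D ta = Qd (s ta) -> W ta = Qdd (s ta) ->
  forall t, ta <= t <= tb -> X t = Q (s t).
Proof.
  intros hc hd hQ e0 e1 e2 t ht.
  set (d0 := fun t => X t - Q (s t)). set (d1 := fun t => D t - Qd (s t)).
  set (d2 := fun t => W t - Qdd (s t)).
  (* By [2 x y <= x^2 + y^2], this constant dominates the cross terms
     [2 d0 d1 + 2 d1 d2 + 4 E d1 d2]. *)
  set (K := 2 + 2 * Rabs E).
  set (f := fun t => (d0 t ^ 2 + d1 t ^ 2 + d2 t ^ 2) * exp (- K * s t)).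
  assert (cmp : forall F G g, (forall x, is_derive G x (g x)) -> forall x,
    continuity_pt F x -> continuity_pt s x -> continuity_pt (fun t => F t - G (s t)) x).
  { intros F G g hG x hF hs. apply (continuity_pt_minus F (fun t => G (s t))); [easy|].
    apply (continuity_pt_comp s G); [easy|]. eapply is_derive_continuity_pt, hG. }
  assert (hf : f t <= f ta).
  { apply (nonincreasing_off_finite f (fun t => exp (- K * s t) / r t *
      (2 * d0 t * d1 t + 2 * d1 t * d2 t + 4 * E * d2 t * d1 t
       - K * (d0 t ^ 2 + d1 t ^ 2 + d2 t ^ 2))) Z); [lra| |].
    - intros x hx. assert (hx' : ta <= x <= tb) by lra.
      destruct (hc x hx') as [c1 [c2 [c3 c4]]].
      assert (k0 : continuity_pt d0 x) by (apply (cmp X Q Qd); [apply hQ|easy|easy]).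
      assert (k1 : continuity_pt d1 x) by (apply (cmp D Qd Qdd); [apply hQ|easy|easy]).
      assert (k2 : continuity_pt d2 x)
        by (apply (cmp W Qdd (fun x => 2 * E * Qd x)); [apply hQ|easy|easy]).
      apply (continuity_pt_ext (fun t => (d0 t * d0 t + d1 t * d1 t + d2 t * d2 t) * exp (- K * s t))).
      { intros y. unfold f. ring. }
      apply (continuity_pt_mult (fun t => d0 t * d0 t + d1 t * d1 t + d2 t * d2 t)
        (fun t => exp (- K * s t))).
      + exact (continuity_pt_plus _ _ _ (continuity_pt_plus _ _ _
          (continuity_pt_mult _ _ _ k0 k0) (continuity_pt_mult _ _ _ k1 k1))
          (continuity_pt_mult _ _ _ k2 k2)).
      + apply (continuity_pt_comp (fun t => - K * s t) exp).
        * apply (continuity_pt_scal s). easy.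
        * apply derivable_continuous_pt, derivable_pt_exp.
    - intros x hx hn. assert (hx' : ta <= x <= tb) by lra.
      destruct (hd x hx' hn) as [hr [g1 [g2 [g3 g4]]]].
      destruct (hQ (s x)) as [q1 [q2 q3]].
      assert (k0 : is_derive d0 x (d1 x / r x)).
      { replace (d1 x / r x) with (D x / r x - Qd (s x) * (1 / r x)) by (unfold d1; field; lra).
        apply (is_derive_minus X (fun t => Q (s t))); [easy|]. now apply is_derive_compose. }
      assert (k1 : is_derive d1 x (d2 x / r x)).
      { replace (d2 x / r x) with (W x / r x - Qdd (s x) * (1 / r x)) by (unfold d2; field; lra).
        apply (is_derive_minus D (fun t => Qd (s t))); [easy|]. now apply is_derive_compose. }
      assert (k2 : is_derive d2 x (2 * E * d1 x / r x)).
      { replace (2 * E * d1 x / r x)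
          with (2 * E * D x / r x - 2 * E * Qd (s x) * (1 / r x)) by (unfold d1; field; lra).
        apply (is_derive_minus W (fun t => Qdd (s t))); [easy|]. now apply is_derive_compose. }
      split.
      + unfold f. clearbody d0 d1 d2. auto_derive.
        * repeat split; eexists; eassumption.
        * rew_derive k0. rew_derive k1. rew_derive k2. rew_derive g4. field. lra.
      + enough (2 * d0 x * d1 x + 2 * d1 x * d2 x + 4 * E * d2 x * d1 x
         - K * (d0 x ^ 2 + d1 x ^ 2 + d2 x ^ 2) <= 0) as hneg.
        { assert (0 < exp (- K * s x) / r x)
            by (apply Rdiv_lt_0_compat; [apply exp_pos|easy]). nra. }
        unfold K. generalize (d0 x) (d1 x) (d2 x). intros y0 y1 y2.
        assert (hE : 4 * E * y2 * y1 <= 2 * Rabs E * (y1 ^ 2 + y2 ^ 2)).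
        { unfold Rabs; destruct (Rcase_abs E) as [hE|hE].
          - pose proof (pow2_ge_0 (y1 + y2)). nra.
          - pose proof (pow2_ge_0 (y1 - y2)). nra. }
        pose proof (Rabs_pos E). pose proof (pow2_ge_0 y0).
        assert (0 <= Rabs E * y0 ^ 2) by nra.
        pose proof (pow2_ge_0 (y0 - y1)). pose proof (pow2_ge_0 (y1 - y2)). nra. }
  assert (h0 : f ta = 0).
  { unfold f, d0, d1, d2. rewrite e0, e1, e2. ring. }
  rewrite h0 in hf. unfold f in hf.
  pose proof (exp_pos (- K * s t)).
  pose proof (pow2_ge_0 (d0 t)). pose proof (pow2_ge_0 (d1 t)). pose proof (pow2_ge_0 (d2 t)).
  assert (d0 t ^ 2 <= 0) by nra.
  assert (d0 t = 0) as hh by nra. unfold d0 in hh. lra.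
Qed.

Definition zQ1 (k a1 a2 u1 u2 s : R) : R := zc k a1 u1 s ^ 2 - zc k a2 u2 s ^ 2.
Definition zQ2 (k a1 a2 u1 u2 s : R) : R := 2 * zc k a1 u1 s * zc k a2 u2 s.

(* [s] is the Sundman time of the orbit [z^2], with [z] the solution of [z'' = k z]
   with initial data [a], [u]. *)
Definition lc_lift (X Y s : R -> R) (k a1 a2 u1 u2 ta tb : R) : Prop :=
  forall t, ta <= t <= tb ->
    X t = zQ1 k a1 a2 u1 u2 (s t) /\ Y t = zQ2 k a1 a2 u1 u2 (s t) /\
    ztau k a1 a2 u1 u2 (s t) = t - ta.

(* The solution in Sundman time [s], with [D = dq/ds] and [W = d^2q/ds^2];
   [Z] contains the collision times. *)
Definition sundman (X Y r s D1 D2 W1 W2 : R -> R) (Z : list R) (E ta tb : R) : Prop :=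
  forall t, ta <= t <= tb ->
    (0 <= r t /\ r t ^ 2 = X t ^ 2 + Y t ^ 2) /\
    (continuity_pt X t /\ continuity_pt D1 t /\ continuity_pt W1 t /\
     continuity_pt Y t /\ continuity_pt D2 t /\ continuity_pt W2 t /\ continuity_pt s t) /\
    (~ In t Z -> 0 < r t /\
      is_derive X t (D1 t / r t) /\ is_derive D1 t (W1 t / r t) /\
      is_derive W1 t (2 * E * D1 t / r t) /\
      is_derive Y t (D2 t / r t) /\ is_derive D2 t (W2 t / r t) /\
      is_derive W2 t (2 * E * D2 t / r t) /\ is_derive s t (1 / r t)).

(** Both coordinates of [z^2] satisfy [Q''' = 4 k Q'], so it is enough to match three initial data
    for each. Then [|z|^2 = r], whence [ztau (s t) - t] has zero derivative off [Z]. *)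
Lemma sundman_lift (X Y r s D1 D2 W1 W2 : R -> R) (Z : list R) (k a1 a2 u1 u2 ta tb : R) :
  ta <= tb -> sundman X Y r s D1 D2 W1 W2 Z (2 * k) ta tb -> s ta = 0 ->
  X ta = a1 ^ 2 - a2 ^ 2 -> Y ta = 2 * a1 * a2 ->
  D1 ta = 2 * (a1 * u1 - a2 * u2) -> D2 ta = 2 * (a1 * u2 + a2 * u1) ->
  W1 ta = 2 * (u1 ^ 2 - u2 ^ 2) + 2 * k * (a1 ^ 2 - a2 ^ 2) ->
  W2 ta = 4 * u1 * u2 + 2 * k * (2 * a1 * a2) ->
  lc_lift X Y s k a1 a2 u1 u2 ta tb.
Proof.
  intros hab h s0 x0 y0 dx dy wx wy.
  assert (hX : forall t, ta <= t <= tb -> X t = zQ1 k a1 a2 u1 u2 (s t)).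
  { apply (regularized_uniqueness X D1 W1 r s (zQ1 k a1 a2 u1 u2)
     (fun s => 2 * (zc k a1 u1 s * zd k a1 u1 s - zc k a2 u2 s * zd k a2 u2 s))
     (fun s => 2 * (zd k a1 u1 s ^ 2 - zd k a2 u2 s ^ 2) + 2 * k * (zc k a1 u1 s ^ 2 - zc k a2 u2 s ^ 2))
     (2 * k) ta tb Z).
    - intros t ht. specialize (h t ht). tauto.
    - intros t ht hn. specialize (h t ht). tauto.
    - intros x. unfold zQ1. split; [|split]; zderive; ring.
    - rewrite s0. unfold zQ1. rewrite !zc_0. easy.
    - rewrite s0, !zc_0, !zd_0. easy.
    - rewrite s0, !zc_0, !zd_0. easy. }
  assert (hY : forall t, ta <= t <= tb -> Y t = zQ2 k a1 a2 u1 u2 (s t)).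
  { apply (regularized_uniqueness Y D2 W2 r s (zQ2 k a1 a2 u1 u2)
     (fun s => 2 * (zc k a1 u1 s * zd k a2 u2 s + zc k a2 u2 s * zd k a1 u1 s))
     (fun s => 4 * zd k a1 u1 s * zd k a2 u2 s + 2 * k * (2 * zc k a1 u1 s * zc k a2 u2 s))
     (2 * k) ta tb Z).
    - intros t ht. specialize (h t ht). tauto.
    - intros t ht hn. specialize (h t ht). tauto.
    - intros x. unfold zQ2. split; [|split]; zderive; ring.
    - rewrite s0. unfold zQ2. rewrite !zc_0. easy.
    - rewrite s0, !zc_0, !zd_0. easy.
    - rewrite s0, !zc_0, !zd_0. easy. }
  intros t ht. split; [now apply hX|]. split; [now apply hY|].
  enough (e : ztau k a1 a2 u1 u2 (s t) - t = ztau k a1 a2 u1 u2 (s ta) - ta).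
  { rewrite s0, ztau_0 in e. lra. }
  apply (constant_off_finite (fun t => ztau k a1 a2 u1 u2 (s t) - t) Z); [lra| |].
  - intros x hx.
    apply (continuity_pt_minus (fun t => ztau k a1 a2 u1 u2 (s t)) id).
    + apply (continuity_pt_comp s (ztau k a1 a2 u1 u2)); [apply h; lra|].
      eapply is_derive_continuity_pt, ztau_derive.
    + apply derivable_continuous_pt, derivable_pt_id.
  - intros x hx hn. assert (hx' : ta <= x <= tb) by lra.
    destruct (h x hx') as [[r0 r1] [_ hd]]. destruct (hd hn) as [rp [_ [_ [_ [_ [_ [_ ds]]]]]]].
    rewrite (hX x hx'), (hY x hx') in r1. unfold zQ1, zQ2 in r1.
    pose proof (pow2_ge_0 (zc k a1 u1 (s x))). pose proof (pow2_ge_0 (zc k a2 u2 (s x))).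
    assert (er : zc k a1 u1 (s x) ^ 2 + zc k a2 u2 (s x) ^ 2 = r x).
    { apply Rsqr_inj; [lra|lra|]. unfold Rsqr. nra. }
    replace 0 with ((zc k a1 u1 (s x) ^ 2 + zc k a2 u2 (s x) ^ 2) * (1 / r x) - 1)
      by (rewrite er; field; lra).
    apply (is_derive_minus (fun t => ztau k a1 a2 u1 u2 (s t)) (fun t => t)).
    + apply is_derive_compose; [apply ztau_derive|easy].
    + apply (is_derive_id x).
Qed.

(** * Lifting Keplerian arcs *)

Definition arc_lift (O : pt) (q : R -> pt) (s : R -> R) (k a1 a2 u1 u2 ta tb : R) : Prop :=
  lc_energy k a1 a2 u1 u2 /\ s ta = 0 /\
  lc_lift (fun t => fst (q t) - fst O) (fun t => snd (q t) - snd O) s k a1 a2 u1 u2 ta tb.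

Lemma sundman_lift_initial (X Y r s D1 D2 W1 W2 : R -> R) (Z : list R)
  (E a1 a2 v1 v2 ta tb : R) :
  ta <= tb -> sundman X Y r s D1 D2 W1 W2 Z E ta tb -> s ta = 0 ->
  0 < r ta -> X ta = a1 ^ 2 - a2 ^ 2 -> Y ta = 2 * a1 * a2 ->
  E = (v1 ^ 2 + v2 ^ 2) / 2 - 1 / r ta ->
  D1 ta = r ta * v1 -> D2 ta = r ta * v2 ->
  W1 ta = (X ta * v1 + Y ta * v2) * v1 - X ta / r ta ->
  W2 ta = (X ta * v1 + Y ta * v2) * v2 - Y ta / r ta ->
  exists k u1 u2, lc_energy k a1 a2 u1 u2 /\ lc_lift X Y s k a1 a2 u1 u2 ta tb.
Proof.
  intros hab h s0 hr hX hY hE d1 d2 w1 w2.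
  (* In complex notation [r v = 2 a u] with [r = |a|^2], so [u] is half the product of [v] with the
     conjugate of [a]. *)
  exists (E / 2), ((a1 * v1 + a2 * v2) / 2), ((a1 * v2 - a2 * v1) / 2).
  assert (er : r ta = a1 ^ 2 + a2 ^ 2).
  { destruct (h ta) as [[_ e] _]; [lra|]. rewrite hX, hY in e.
    apply Rsqr_inj; [lra|nra|]. unfold Rsqr. nra. }
  rewrite hX, hY in w1, w2. rewrite er in *.
  split.
  - unfold lc_energy. rewrite hE. field. lra.
  - apply (sundman_lift X Y r s D1 D2 W1 W2 Z); try easy.
    + replace (2 * (E / 2)) with E by field. easy.
    + rewrite d1. field.
    + rewrite d2. field.
    + rewrite w1, hE. field. lra.
    + rewrite w2, hE. field. lra.
Qed.

Lemma kepler_regular_arc_lift (O : pt) (q : R -> pt) (a1 a2 ta tb : R) :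
  ta < tb -> kepler_regular O q ta tb ->
  fst (q ta) - fst O = a1 ^ 2 - a2 ^ 2 -> snd (q ta) - snd O = 2 * a1 * a2 ->
  exists s k u1 u2, arc_lift O q s k a1 a2 u1 u2 ta tb.
Proof.
  intros hab [v hv] hX hY.
  set (X := fun t => fst (q t) - fst O) in *. set (Y := fun t => snd (q t) - snd O) in *.
  set (V1 := fun t => fst (v t)). set (V2 := fun t => snd (v t)).
  set (r := fun t => sqrt (X t ^ 2 + Y t ^ 2)).
  assert (hr : forall t, ta <= t <= tb -> 0 < r t /\
    is_derive X t (V1 t) /\ is_derive Y t (V2 t) /\
    is_derive V1 t (- X t / r t ^ 3) /\ is_derive V2 t (- Y t / r t ^ 3) /\
    is_derive r t ((X t * V1 t + Y t * V2 t) / r t)).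
  { intros t ht. destruct (hv t ht) as [hO [h1 [h2 [h3 h4]]]].
    assert (hp : 0 < X t ^ 2 + Y t ^ 2).
    { destruct (Rlt_dec 0 (X t ^ 2 + Y t ^ 2)) as [l|l]; [easy|exfalso; apply hO].
      pose proof (pow2_ge_0 (X t)). pose proof (pow2_ge_0 (Y t)).
      assert (X t = 0) by nra. assert (Y t = 0) by nra. unfold X, Y in *.
      rewrite (surjective_pairing (q t)), (surjective_pairing O). f_equal; lra. }
    assert (hrp : 0 < r t) by (apply sqrt_lt_R0; easy).
    apply is_derive_Reals in h1, h2, h3, h4.
    assert (dX : is_derive X t (V1 t)).
    { unfold X. replace (V1 t) with (V1 t - 0) by ring.
      apply (is_derive_minus (fun t => fst (q t)) (fun _ => fst O)); [easy|].
      apply (is_derive_const (fst O)). }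
    assert (dY : is_derive Y t (V2 t)).
    { unfold Y. replace (V2 t) with (V2 t - 0) by ring.
      apply (is_derive_minus (fun t => snd (q t)) (fun _ => snd O)); [easy|].
      apply (is_derive_const (snd O)). }
    repeat (split; [easy|]).
    unfold r in *. clearbody X Y. auto_derive.
    - repeat split; try (eexists; eassumption). simpl in hp. lra.
    - rew_derive dX. rew_derive dY.
      replace (X t * (X t * 1) + Y t * (Y t * 1)) with (X t ^ 2 + Y t ^ 2) by ring.
      field. lra. }
  assert (hr2 : forall t, r t ^ 2 = X t ^ 2 + Y t ^ 2).
  { intros t. unfold r. apply pow2_sqrt.
    pose proof (pow2_ge_0 (X t)). pose proof (pow2_ge_0 (Y t)). lra. }
  clearbody r V1 V2.
  set (E := (V1 ta ^ 2 + V2 ta ^ 2) / 2 - 1 / r ta).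
  assert (hE : forall t, ta <= t <= tb -> (V1 t ^ 2 + V2 t ^ 2) / 2 - 1 / r t = E).
  { intros t ht.
    assert (hd : forall x, ta <= x <= tb ->
       is_derive (fun t => (V1 t ^ 2 + V2 t ^ 2) / 2 - 1 / r t) x 0).
    { intros x hx. destruct (hr x hx) as [rp [d1 [d2 [d3 [d4 d5]]]]].
      auto_derive.
      - repeat split; try (eexists; eassumption). lra.
      - rew_derive d3. rew_derive d4. rew_derive d5. field. lra. }
    apply (constant_off_finite (fun t => (V1 t ^ 2 + V2 t ^ 2) / 2 - 1 / r t) nil); [lra| |].
    - intros x hx. eapply is_derive_continuity_pt, hd. lra.
    - intros x hx _. apply hd. lra. }
  (* The virial identity [d(q . v)/dt = 2 E + 1/r] gives the Sundman time without integration. *)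
  set (s := fun t => X t * V1 t + Y t * V2 t - 2 * E * t
     - (X ta * V1 ta + Y ta * V2 ta - 2 * E * ta)).
  assert (hs0 : s ta = 0) by (unfold s; ring).
  enough (exists k u1 u2, lc_energy k a1 a2 u1 u2 /\ lc_lift X Y s k a1 a2 u1 u2 ta tb)
    as [k [u1 [u2 [h1 h2]]]].
  { exists s, k, u1, u2. easy. }
  (* The Sundman derivative is [r d/dt]: it sends [q] to [r v], and [r v] to [(q . v) v - q / r]. *)
  apply (sundman_lift_initial X Y r s (fun t => r t * V1 t) (fun t => r t * V2 t)
    (fun t => (X t * V1 t + Y t * V2 t) * V1 t - X t / r t)
    (fun t => (X t * V1 t + Y t * V2 t) * V2 t - Y t / r t) nil E a1 a2 (V1 ta) (V2 ta));
    try easy; [lra| |apply hr; lra].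
  intros t ht. destruct (hr t ht) as [rp [d1 [d2 [d3 [d4 d5]]]]].
  specialize (hr2 t). specialize (hE t ht).
  assert (D1 : is_derive (fun t => r t * V1 t) t
    (((X t * V1 t + Y t * V2 t) * V1 t - X t / r t) / r t)).
  { clearbody X Y. auto_derive; [repeat split; eexists; eassumption|].
    rew_derive d3. rew_derive d5. field. lra. }
  assert (D2 : is_derive (fun t => r t * V2 t) t
    (((X t * V1 t + Y t * V2 t) * V2 t - Y t / r t) / r t)).
  { clearbody X Y. auto_derive; [repeat split; eexists; eassumption|].
    rew_derive d4. rew_derive d5. field. lra. }
  assert (hdot : is_derive (fun t => X t * V1 t + Y t * V2 t) t (2 * E + 1 / r t)).
  { clearbody X Y E. auto_derive; [repeat split; eexists; eassumption|].
    rew_derive d1. rew_derive d2. rew_derive d3. rew_derive d4. rewrite <- hE.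
    transitivity (V1 t ^ 2 + V2 t ^ 2 - (X t ^ 2 + Y t ^ 2) / r t ^ 3); [field; lra|].
    rewrite <- hr2. field. lra. }
  set (p := fun t => X t * V1 t + Y t * V2 t) in *.
  change (is_derive p t (2 * E + 1 / r t)) in hdot.
  assert (W1 : is_derive (fun t => p t * V1 t - X t / r t) t (2 * E * (r t * V1 t) / r t)).
  { assert (hp : p t = X t * V1 t + Y t * V2 t) by easy.
    clearbody X Y p. auto_derive; [repeat split; try (eexists; eassumption); lra|].
    rew_derive d1. rew_derive d3. rew_derive d5. rew_derive hdot. rewrite <- hp. field. lra. }
  assert (W2 : is_derive (fun t => p t * V2 t - Y t / r t) t (2 * E * (r t * V2 t) / r t)).
  { assert (hp : p t = X t * V1 t + Y t * V2 t) by easy.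
    clearbody X Y p. auto_derive; [repeat split; try (eexists; eassumption); lra|].
    rew_derive d2. rew_derive d4. rew_derive d5. rew_derive hdot. rewrite <- hp. field. lra. }
  assert (ds : is_derive s t (1 / r t)).
  { change s with (fun t => p t - 2 * E * t - (p ta - 2 * E * ta)).
    clearbody X Y p. auto_derive; [repeat split; eexists; eassumption|].
    rew_derive hdot. ring. }
  split; [split; [lra|easy]|]. split.
  - repeat split; eapply is_derive_continuity_pt; eassumption.
  - intros _. split; [easy|].
    replace (r t * V1 t / r t) with (V1 t) by (field; lra).
    replace (r t * V2 t / r t) with (V2 t) by (field; lra).
    easy.
Qed.

Lemma kepler_rectilinear_arc_lift (O : pt) (q : R -> pt) (a1 a2 ta tb : R) :
  ta < tb -> q ta <> O -> q tb <> O -> kepler_rectilinear O q ta tb ->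
  fst (q ta) - fst O = a1 ^ 2 - a2 ^ 2 -> snd (q ta) - snd O = 2 * a1 * a2 ->
  exists s k u1 u2, arc_lift O q s k a1 a2 u1 u2 ta tb.
Proof.
  intros hab na nb [[n1 n2] [r [w [E [Z [hn h]]]]]] hX hY.
  assert (n2' : n1 ^ 2 + n2 ^ 2 = 1).
  { unfold pnorm in hn; cbn [fst snd] in hn.
    rewrite <- (pow2_sqrt (n1 ^ 2 + n2 ^ 2)), hn; [ring|].
    pose proof (pow2_ge_0 n1). pose proof (pow2_ge_0 n2). lra. }
  assert (hq : forall t, ta <= t <= tb ->
    fst (q t) - fst O = r t * n1 /\ snd (q t) - snd O = r t * n2).
  { intros t ht. destruct (h t ht) as [e _]. rewrite e. unfold padd, pscal; simpl. lra. }
  assert (hpos : forall t, ta <= t <= tb -> q t <> O -> 0 < r t).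
  { intros t ht hne. destruct (h t ht) as [e [[h1|h1] _]]; [easy|exfalso; apply hne].
    rewrite e, <- h1. unfold padd, pscal. destruct O; simpl. f_equal; ring. }
  pose proof (hpos ta ltac:(lra) na) as ra. pose proof (hpos tb ltac:(lra) nb) as rb.
  (* This is [r r'] with value [0] at collisions. The energy gives [d ^ 2 = 2 r + 2 E r ^ 2], so [d]
     is continuous through a bounce although [w] is unbounded near it. *)
  set (d := fun t => if Rlt_dec 0 (r t) then r t * w t else 0).
  set (s := fun t => d t - 2 * E * t - (d ta - 2 * E * ta)).
  assert (hd : forall t, ta <= t <= tb -> 0 < r t ->
    is_derive r t (w t) /\ is_derive d t (2 * E + 1 / r t)).
  { intros t ht rp. destruct (h t ht) as [_ [_ [cr [_ hd]]]].
    destruct (hd rp) as [d1 [d2 e]]. apply is_derive_Reals in d1, d2.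
    split; [easy|].
    apply (is_derive_ext_loc (fun t => r t * w t)).
    - apply continuity_pt_locally with (eps := mkposreal _ rp) in cr.
      revert cr. apply filter_imp. intros y hy. simpl in hy. apply Rabs_def2 in hy.
      unfold d. destruct (Rlt_dec 0 (r y)); [easy|lra].
    - auto_derive; [repeat split; eexists; eassumption|].
      rew_derive d1. rew_derive d2. rewrite <- e. field. lra. }
  assert (hd2 : forall t, ta <= t <= tb -> d t ^ 2 = 2 * r t + 2 * E * r t ^ 2).
  { intros t ht. unfold d. destruct (Rlt_dec 0 (r t)) as [rp|rp].
    - destruct (h t ht) as [_ [_ [_ [_ hh]]]]. destruct (hh rp) as [_ [_ e]].
      rewrite <- e. field. lra.
    - destruct (h t ht) as [_ [r0 _]]. replace (r t) with 0 by lra. ring. }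
  assert (cd : forall t, ta <= t <= tb -> continuity_pt d t).
  { intros t ht. destruct (Rlt_dec 0 (r t)) as [rp|rp].
    - eapply is_derive_continuity_pt, hd; easy.
    - destruct (h t ht) as [_ [r0 [cr _]]].
      assert (rt : r t = 0) by lra.
      (* The endpoints are not collisions, so the instant is interior and has a two-sided
         neighbourhood on which [hd2] holds. *)
      assert (hta : ta < t) by (destruct (Req_dec t ta) as [->|]; lra).
      assert (htb : t < tb) by (destruct (Req_dec t tb) as [->|]; lra).
      apply continuity_pt_locally. intros eps.
      assert (cF : continuity_pt (fun t => 2 * r t + 2 * E * (r t * r t)) t).
      { exact (continuity_pt_plus _ _ _ (continuity_pt_scal _ 2 _ cr)
          (continuity_pt_scal _ (2 * E) _ (continuity_pt_mult _ _ _ cr cr))). }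
      assert (he : 0 < eps * eps) by (destruct eps as [e he]; simpl; nra).
      apply continuity_pt_locally with (eps := mkposreal _ he) in cF.
      assert (hI : locally t (fun y => ta <= y <= tb)).
      { assert (hm : 0 < Rmin (t - ta) (tb - t)) by (apply Rmin_pos; lra).
        exists (mkposreal _ hm). intros y hy.
        apply ball_bounds in hy; simpl in hy.
        pose proof (Rmin_l (t - ta) (tb - t)). pose proof (Rmin_r (t - ta) (tb - t)). lra. }
      generalize (filter_and _ _ cF hI). apply filter_imp. intros y [h1 h2]. simpl in h1.
      replace (d t) with 0 by (unfold d; destruct (Rlt_dec 0 (r t)); easy).
      rewrite rt in h1. specialize (hd2 y h2). rewrite Rminus_0_r.
      destruct eps as [e ep]; simpl in *.
      apply Rabs_def2 in h1.
      assert (hlt : d y * d y < e * e) by nra.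
      apply Rabs_def1; nra. }
  enough (exists k u1 u2, lc_energy k a1 a2 u1 u2
    /\ lc_lift (fun t => r t * n1) (fun t => r t * n2) s k a1 a2 u1 u2 ta tb)
    as [k [u1 [u2 [h1 h2]]]].
  { exists s, k, u1, u2. split; [easy|]. split; [unfold s; ring|].
    intros t ht. destruct (hq t ht) as [-> ->]. apply (h2 t ht). }
  destruct (hq ta) as [q1 q2]; [lra|].
  destruct (h ta) as [_ [_ [_ [_ hh]]]]; [split; lra|]. destruct (hh ra) as [_ [_ e]].
  (* Since [d' = 2 E + 1 / r], the second Sundman derivative of [r] is [1 + 2 E r], regular at
     collisions. *)
  apply (sundman_lift_initial (fun t => r t * n1) (fun t => r t * n2) r s
    (fun t => d t * n1) (fun t => d t * n2)
    (fun t => (1 + 2 * E * r t) * n1) (fun t => (1 + 2 * E * r t) * n2)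
    Z E a1 a2 (w ta * n1) (w ta * n2)); try lra.
  - intros t ht. destruct (h t ht) as [_ [r0 [cr [hZ _]]]].
    specialize (cd t ht).
    assert (cc : forall c, continuity_pt (fun _ => c) t)
      by (intros c; now apply continuity_pt_const).
    pose proof (continuity_pt_plus _ _ _ (cc 1) (continuity_pt_scal _ (2 * E) _ cr)) as cw.
    split; [split; [easy|]|split].
    + transitivity (r t ^ 2 * (n1 ^ 2 + n2 ^ 2)); [rewrite n2'; ring|ring].
    + split; [exact (continuity_pt_mult _ _ _ cr (cc n1))|].
      split; [exact (continuity_pt_mult _ _ _ cd (cc n1))|].
      split; [exact (continuity_pt_mult _ _ _ cw (cc n1))|].
      split; [exact (continuity_pt_mult _ _ _ cr (cc n2))|].
      split; [exact (continuity_pt_mult _ _ _ cd (cc n2))|].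
      split; [exact (continuity_pt_mult _ _ _ cw (cc n2))|].
      unfold s.
      apply (continuity_pt_minus (fun t => d t - 2 * E * t)); [|apply cc].
      apply (continuity_pt_minus d (fun t => 2 * E * t)); [easy|].
      apply (continuity_pt_scal id), derivable_continuous_pt, derivable_pt_id.
    + intros hn'. assert (rp : 0 < r t) by (destruct r0 as [|r0]; [easy|symmetry in r0; tauto]).
      destruct (hd t ht rp) as [dr dd].
      assert (edw : d t = r t * w t) by (unfold d; destruct (Rlt_dec 0 (r t)); easy).
      split; [easy|].
      assert (hs : forall c, is_derive (fun t => r t * c) t (d t * c / r t)).
      { intros c. auto_derive; [repeat split; eexists; eassumption|]. rew_derive dr.
        rewrite edw. field. lra. }
      assert (hds : forall c, is_derive (fun t => d t * c) t ((1 + 2 * E * r t) * c / r t)).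
      { intros c. clearbody d. auto_derive; [repeat split; eexists; eassumption|]. rew_derive dd.
        field. lra. }
      assert (hw : forall c, is_derive (fun t => (1 + 2 * E * r t) * c) t
         (2 * E * (d t * c) / r t)).
      { intros c. rewrite edw. clearbody d. auto_derive; [repeat split; eexists; eassumption|].
        rew_derive dr. field. lra. }
      do 6 (split; [auto|]).
      unfold s. clearbody d. auto_derive; [repeat split; eexists; eassumption|].
      rew_derive dd. ring.
  - unfold s; ring.
  - rewrite <- e.
    transitivity (w ta ^ 2 * (n1 ^ 2 + n2 ^ 2) / 2 - 1 / r ta); [rewrite n2'; field; lra|field; lra].
  - unfold d. destruct (Rlt_dec 0 (r ta)); [ring|easy].
  - unfold d. destruct (Rlt_dec 0 (r ta)); [ring|easy].
  - rewrite <- e.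
    transitivity (r ta * w ta ^ 2 * n1 * (n1 ^ 2 + n2 ^ 2) - n1);
      [rewrite n2'; field; lra|field; lra].
  - rewrite <- e.
    transitivity (r ta * w ta ^ 2 * n2 * (n1 ^ 2 + n2 ^ 2) - n2);
      [rewrite n2'; field; lra|field; lra].
Qed.

(** * Simple arcs and half periods *)

Lemma complex_sqrt (X Y : R) : exists a1 a2, X = a1 ^ 2 - a2 ^ 2 /\ Y = 2 * a1 * a2.
Proof.
  set (r := sqrt (X ^ 2 + Y ^ 2)).
  assert (hr : 0 <= r) by apply sqrt_pos.
  assert (hr2 : r ^ 2 = X ^ 2 + Y ^ 2) by (apply pow2_sqrt; nra).
  assert (hX : - r <= X <= r) by (split; nra).
  set (a := sqrt ((r + X) / 2)). set (b := sqrt ((r - X) / 2)).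
  assert (ha : a ^ 2 = (r + X) / 2) by (apply pow2_sqrt; lra).
  assert (hb : b ^ 2 = (r - X) / 2) by (apply pow2_sqrt; lra).
  assert (hab : a * b = Rabs Y / 2).
  { assert (0 <= a) by apply sqrt_pos. assert (0 <= b) by apply sqrt_pos.
    apply Rsqr_inj; [nra|pose proof (Rabs_pos Y); lra|].
    unfold Rsqr. transitivity (a ^ 2 * b ^ 2); [ring|]. rewrite ha, hb.
    replace (Rabs Y / 2 * (Rabs Y / 2)) with (Rabs Y ^ 2 / 4) by field.
    rewrite pow2_abs. nra. }
  destruct (Rle_dec 0 Y) as [h|h].
  - exists a, b. rewrite Rabs_right in hab by lra. split; lra.
  - exists a, (- b). rewrite Rabs_left in hab by lra. split; [|lra].
    replace ((- b) ^ 2) with (b ^ 2) by ring. lra.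
Qed.

Lemma sum_squares_zero (x y : R) : x ^ 2 + y ^ 2 = 0 -> x = 0 /\ y = 0.
Proof. intros h. split; nra. Qed.

(** In complex notation, [|x - b|^2 |x + b|^2 = |x^2 - b^2|^2]. *)
Lemma complex_square_inj (x1 x2 b1 b2 : R) :
  x1 ^ 2 - x2 ^ 2 = b1 ^ 2 - b2 ^ 2 -> 2 * x1 * x2 = 2 * b1 * b2 ->
  (x1 = b1 /\ x2 = b2) \/ (x1 = - b1 /\ x2 = - b2).
Proof.
  intros h1 h2.
  assert (e : ((x1 - b1) ^ 2 + (x2 - b2) ^ 2) * ((x1 + b1) ^ 2 + (x2 + b2) ^ 2) = 0).
  { transitivity ((x1 ^ 2 - x2 ^ 2 - (b1 ^ 2 - b2 ^ 2)) ^ 2 + (2 * x1 * x2 - 2 * b1 * b2) ^ 2);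
      [ring|]. rewrite h1, h2. ring. }
  apply Rmult_integral in e. destruct e as [e|e]; apply sum_squares_zero in e; [left|right]; lra.
Qed.

Lemma complex_mul_cancel (a1 a2 u1 u2 w1 w2 : R) : 0 < a1 ^ 2 + a2 ^ 2 ->
  a1 * u1 - a2 * u2 = a1 * w1 - a2 * w2 -> a1 * u2 + a2 * u1 = a1 * w2 + a2 * w1 ->
  u1 = w1 /\ u2 = w2.
Proof.
  intros ha h1 h2.
  assert (e : (a1 ^ 2 + a2 ^ 2) * ((u1 - w1) ^ 2 + (u2 - w2) ^ 2) = 0).
  { transitivity ((a1 * u1 - a2 * u2 - (a1 * w1 - a2 * w2)) ^ 2
      + (a1 * u2 + a2 * u1 - (a1 * w2 + a2 * w1)) ^ 2); [ring|]. rewrite h1, h2. ring. }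
  apply Rmult_integral in e. destruct e as [e|e]; [lra|]. apply sum_squares_zero in e. lra.
Qed.

(** The energy fixes [|u|^2]. Inserted in the squared modulus of [u S = z(x) - a C], it gives the
    first equation; inserted in [ztau], it leaves [S] times [a . (a C + u S)] plus [J / 2], by
    [kJ_relation]. *)
Lemma lambert_of_orbit (k a1 a2 u1 u2 x : R) : lc_energy k a1 a2 u1 u2 -> early k x ->
  lambert (a1 ^ 2 + a2 ^ 2 + (zc k a1 u1 x ^ 2 + zc k a2 u2 x ^ 2))
    (a1 * zc k a1 u1 x + a2 * zc k a2 u2 x) (ztau k a1 a2 u1 u2 x) k x.
Proof.
  intros hE hx. unfold lc_energy in hE.
  assert (hu : u1 ^ 2 + u2 ^ 2 = 1 / 2 + k * (a1 ^ 2 + a2 ^ 2)) by lra.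
  pose proof (kCS_unit k x) as hc. pose proof (kJ_relation k x) as hJ.
  split; [easy|]. unfold zc, ztau. split.
  - transitivity (2 * ((u1 ^ 2 + u2 ^ 2) * kS k x ^ 2
       + (a1 ^ 2 + a2 ^ 2) * (kC k x ^ 2 - k * kS k x ^ 2 - kC k x ^ 2))).
    + rewrite hu. field.
    + rewrite hc. ring.
  - rewrite hu.
    transitivity ((a1 ^ 2 + a2 ^ 2) * (x + 2 * k * kJ k x)
      + (a1 * u1 + a2 * u2) * kS k x ^ 2 + kJ k x / 2); [field|].
    rewrite hJ. ring.
Qed.

(** As [S] is not zero, the end condition forces [u]; for this [u] the first equation is the energy
    relation multiplied by [S^2]. *)
Lemma orbit_of_lambert (k a1 a2 b1 b2 x T : R) :
  lambert (a1 ^ 2 + a2 ^ 2 + (b1 ^ 2 + b2 ^ 2)) (a1 * b1 + a2 * b2) T k x ->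
  exists u1 u2, lc_energy k a1 a2 u1 u2 /\ zc k a1 u1 x = b1 /\ zc k a2 u2 x = b2 /\
    ztau k a1 a2 u1 u2 x = T.
Proof.
  intros [hx [h1 h2]]. pose proof (early_kS _ _ hx) as hs.
  exists ((b1 - a1 * kC k x) / kS k x), ((b2 - a2 * kC k x) / kS k x).
  set (u1 := (b1 - a1 * kC k x) / kS k x). set (u2 := (b2 - a2 * kC k x) / kS k x).
  assert (e1 : zc k a1 u1 x = b1) by (unfold zc, u1; field; lra).
  assert (e2 : zc k a2 u2 x = b2) by (unfold zc, u2; field; lra).
  assert (hE : lc_energy k a1 a2 u1 u2).
  { unfold lc_energy. apply Rmult_eq_reg_r with (kS k x ^ 2); [|pose proof (pow_lt _ 2 hs); lra].
    pose proof (kCS_unit k x) as hc.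
    transitivity (2 * ((b1 - a1 * kC k x) ^ 2 + (b2 - a2 * kC k x) ^ 2)
      + 2 * (a1 ^ 2 + a2 ^ 2) * (kC k x ^ 2 - k * kS k x ^ 2 - kC k x ^ 2)).
    - unfold u1, u2. field. lra.
    - rewrite hc, Rmult_1_l, h1. ring. }
  split; [easy|]. split; [easy|]. split; [easy|].
  destruct (lambert_of_orbit k a1 a2 u1 u2 x hE hx) as [_ [_ h3]].
  rewrite h3, e1, e2. easy.
Qed.

Lemma zc_initial_velocity (k a u u' x : R) : early k x -> zc k a u x = zc k a u' x -> u = u'.
Proof.
  intros hx h. pose proof (early_kS _ _ hx). unfold zc in h. nra.
Qed.

Lemma not_early_half_period (k x : R) : 0 < x -> ~ early k x ->
  exists w, 0 < w /\ k = - w ^ 2 /\ PI / w <= x.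
Proof.
  intros hx hn.
  assert (hv : exists v, 0 < v <= x /\ kS k v <= 0).
  { apply NNPP. intros hh. apply hn. split; [easy|]. intros u hu.
    destruct (Rlt_dec 0 (kS k u)) as [l|l]; [easy|]. exfalso. apply hh. exists u. lra. }
  destruct hv as [v [hv hs]].
  unfold kS in hs. destruct (Rlt_dec k 0) as [hk|hk].
  - assert (hw : 0 < sqrt (- k)) by (apply sqrt_lt_R0; lra).
    exists (sqrt (- k)). split; [easy|]. split; [rewrite pow2_sqrt; lra|].
    set (w := sqrt (- k)) in *.
    assert (PI <= w * v).
    { destruct (Rle_dec PI (w * v)) as [l|l]; [easy|exfalso].
      assert (0 < sin (w * v)) by (apply sin_gt_0; nra).
      assert (0 < sin (w * v) / w) by (apply Rdiv_lt_0_compat; easy). lra. }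
    apply Rmult_le_reg_l with w; [easy|]. replace (w * (PI / w)) with PI by (field; lra). nra.
  - exfalso. destruct (Rlt_dec 0 k) as [hk'|hk'].
    + assert (hw : 0 < sqrt k) by (apply sqrt_lt_R0; lra).
      assert (h0 : 0 < sinh (sqrt k * v)).
      { rewrite <- sinh_0. apply sinh_lt. nra. }
      assert (0 < sinh (sqrt k * v) / sqrt k) by (apply Rdiv_lt_0_compat; easy). lra.
    + lra.
Qed.

Lemma ellipse_values (w s : R) : 0 < w ->
  kC (- w ^ 2) s = cos (w * s) /\ kS (- w ^ 2) s = sin (w * s) / w.
Proof.
  intros hw. replace (- w ^ 2) with (-1 * w ^ 2) by ring.
  rewrite kC_scale, kS_scale by (auto; lra).
  rewrite kC_unit_neg, kS_unit_neg. easy.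
Qed.

(** Since [z] changes sign after [PI / w], this is a full period of the position [z^2]. *)
Lemma zc_half_period (w a u s : R) : 0 < w ->
  zc (- w ^ 2) a u (s + PI / w) = - zc (- w ^ 2) a u s.
Proof.
  intros hw. rewrite zc_plus. destruct (ellipse_values w (PI / w) hw) as [-> ->].
  replace (w * (PI / w)) with PI by (field; lra). rewrite cos_PI, sin_PI. field. lra.
Qed.

Lemma ztau_half_period (w a1 a2 u1 u2 s : R) : 0 < w ->
  ztau (- w ^ 2) a1 a2 u1 u2 (s + PI / w)
  = ztau (- w ^ 2) a1 a2 u1 u2 s + ztau (- w ^ 2) a1 a2 u1 u2 (PI / w).
Proof.
  intros hw.
  assert (hk : - w ^ 2 <> 0) by (pose proof (pow_lt _ 2 hw); lra).
  assert (c1 : kC (- w ^ 2) (PI / w) = -1 /\ kS (- w ^ 2) (PI / w) = 0).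
  { destruct (ellipse_values w (PI / w) hw) as [-> ->].
    replace (w * (PI / w)) with PI by (field; lra). rewrite cos_PI, sin_PI.
    split; [easy|field; lra]. }
  destruct c1 as [c1 s1].
  assert (hJ : kJ (- w ^ 2) (s + PI / w) = kJ (- w ^ 2) s + kJ (- w ^ 2) (PI / w)).
  { unfold kJ. destruct (Req_EM_T (- w ^ 2) 0); [easy|].
    rewrite kC_plus, kS_plus, c1, s1. field. lra. }
  unfold ztau. rewrite hJ, kS_plus, c1, s1. ring.
Qed.

(** [z . z'] is half the Sundman derivative of [|z|^2]. After [PI / (2 * w)] the pair [(z, z')] has
    become [(z' / w, - w z)], so this quantity has changed sign. *)
Lemma apsis_exists (w a1 a2 u1 u2 : R) : 0 < w -> exists x, 0 <= x <= PI / (2 * w) /\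
  zc (- w ^ 2) a1 u1 x * zd (- w ^ 2) a1 u1 x + zc (- w ^ 2) a2 u2 x * zd (- w ^ 2) a2 u2 x = 0.
Proof.
  intros hw. set (k := - w ^ 2).
  set (f := fun x => zc k a1 u1 x * zd k a1 u1 x + zc k a2 u2 x * zd k a2 u2 x).
  pose proof PI_RGT_0 as hPI.
  assert (hL : 0 < PI / (2 * w)) by (apply Rdiv_lt_0_compat; lra).
  assert (hf : f (PI / (2 * w)) = - f 0).
  { unfold f. rewrite <- (Rplus_0_l (PI / (2 * w))), !zc_plus, !zd_plus. unfold k.
    destruct (ellipse_values w (PI / (2 * w)) hw) as [-> ->].
    replace (w * (PI / (2 * w))) with (PI / 2) by (field; lra). rewrite cos_PI2, sin_PI2.
    field. lra. }
  assert (hc : forall x, continuity_pt f x).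
  { intros x. eapply is_derive_continuity_pt. unfold f. zderive. reflexivity. }
  destruct (Rtotal_order (f 0) 0) as [h|[h|h]].
  - destruct (IVT_interv f 0 (PI / (2 * w))) as [x [hx e]]; auto; [lra|].
    exists x. easy.
  - exists 0. split; [lra|easy].
  - destruct (IVT_interv (fun x => - f x) 0 (PI / (2 * w))) as [x [hx e]]; [|lra|lra|lra|].
    + intros x _. apply (continuity_pt_opp f). auto.
    + exists x. split; [easy|]. fold (f x). lra.
Qed.

Lemma arc_lift_at (O : pt) (q : R -> pt) (s : R -> R) (k a1 a2 u1 u2 ta tb x : R) :
  arc_lift O q s k a1 a2 u1 u2 ta tb ->
  0 <= ztau k a1 a2 u1 u2 x <= tb - ta ->
  q (ta + ztau k a1 a2 u1 u2 x)
  = (fst O + zQ1 k a1 a2 u1 u2 x, snd O + zQ2 k a1 a2 u1 u2 x).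
Proof.
  intros [hE [_ hl]] hx.
  destruct (hl (ta + ztau k a1 a2 u1 u2 x) ltac:(lra)) as [h1 [h2 h3]].
  assert (e : s (ta + ztau k a1 a2 u1 u2 x) = x).
  { apply (ztau_inj k a1 a2 u1 u2); [easy|]. rewrite h3. ring. }
  rewrite e in h1, h2.
  rewrite (surjective_pairing (q (ta + ztau k a1 a2 u1 u2 x))).
  f_equal; lra.
Qed.

Lemma simple_arc_early (O : pt) (q : R -> pt) (s : R -> R) (k a1 a2 u1 u2 ta tb : R) :
  ta < tb -> q ta <> q tb -> simple_arc O q ta tb ->
  arc_lift O q s k a1 a2 u1 u2 ta tb -> early k (s tb).
Proof.
  intros hab hne hs hl. apply NNPP. intros hn. apply hs.
  pose proof hl as [hE [hs0 hl']].
  set (tau := ztau k a1 a2 u1 u2) in *.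
  assert (htb : tau (s tb) = tb - ta) by (apply hl'; lra).
  assert (hsp : 0 < s tb).
  { destruct (Rlt_dec 0 (s tb)) as [l|l]; [easy|exfalso].
    pose proof (ztau_le k a1 a2 u1 u2 (s tb) 0 ltac:(lra)) as hh.
    rewrite ztau_0 in hh. fold tau in hh. lra. }
  destruct (not_early_half_period k (s tb) hsp hn) as [w [hw [ek hL]]].
  set (L := PI / w) in *.
  pose proof PI_RGT_0 as hPI.
  assert (hLp : 0 < L) by (apply Rdiv_lt_0_compat; lra).
  assert (t0 : tau 0 = 0) by apply ztau_0.
  assert (hmono : forall x y, x < y -> tau x < tau y) by (intros; apply ztau_lt; easy).
  assert (hmono' : forall x y, x <= y -> tau x <= tau y) by (intros; apply ztau_le; easy).
  assert (hat : forall x, 0 <= x <= s tb ->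
     ta <= ta + tau x <= tb /\
     q (ta + tau x) = (fst O + zQ1 k a1 a2 u1 u2 x, snd O + zQ2 k a1 a2 u1 u2 x)).
  { intros x hx. assert (hx' : 0 <= tau x <= tb - ta).
    { rewrite <- htb, <- t0. split; apply hmono'; lra. }
    split; [lra|]. apply (arc_lift_at O q s k a1 a2 u1 u2 ta tb x hl hx'). }
  assert (hQ : forall x, zQ1 k a1 a2 u1 u2 (x + L) = zQ1 k a1 a2 u1 u2 x /\
                         zQ2 k a1 a2 u1 u2 (x + L) = zQ2 k a1 a2 u1 u2 x).
  { intros x. unfold zQ1, zQ2, L. rewrite ek, !zc_half_period by easy. split; ring. }
  split.
  (* Half a revolution after an apsis, [z] has become [z' / w], orthogonal to its former value. The
     squares therefore point in opposite directions, and [O] lies between the two apsides. *)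
  - destruct (apsis_exists w a1 a2 u1 u2 hw) as [x [hx hz]]. rewrite <- ek in hz.
    assert (hx2 : x + L / 2 <= s tb).
    { assert (PI / (2 * w) = L / 2) by (unfold L; field; lra). lra. }
    pose proof (lc_energy_flow k a1 a2 u1 u2 x hE) as hEx. unfold lc_energy in hEx.
    assert (hv : forall a u, zc k a u (x + L / 2) = zd k a u x / w).
    { intros a u. rewrite zc_plus. rewrite ek at 2 4.
      destruct (ellipse_values w (L / 2) hw) as [-> ->].
      replace (w * (L / 2)) with (PI / 2) by (unfold L; field; lra).
      rewrite cos_PI2, sin_PI2. field. lra. }
    set (y1 := zc k a1 u1 x) in *. set (y2 := zc k a2 u2 x) in *.
    set (d1 := zd k a1 u1 x) in *. set (d2 := zd k a2 u2 x) in *.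
    set (N := y1 ^ 2 + y2 ^ 2 + (d1 ^ 2 + d2 ^ 2) / w ^ 2).
    pose proof (pow_lt _ 2 hw) as hw2.
    assert (hN : 0 < N).
    { unfold N. apply Rmult_lt_reg_r with (w ^ 2); [easy|].
      replace ((y1 ^ 2 + y2 ^ 2 + (d1 ^ 2 + d2 ^ 2) / w ^ 2) * w ^ 2)
        with (w ^ 2 * (y1 ^ 2 + y2 ^ 2) + (d1 ^ 2 + d2 ^ 2)) by (field; lra).
      rewrite ek in hEx. lra. }
    assert (hNe : N <> 0) by lra.
    assert (hD : y1 ^ 2 + y2 ^ 2 = N - (d1 ^ 2 + d2 ^ 2) / w ^ 2) by (unfold N; ring).
    (* Each apsis is weighted by the distance of the other one from [O]. *)
    exists (((d1 ^ 2 + d2 ^ 2) / w ^ 2 / N, q (ta + tau x))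
      :: ((y1 ^ 2 + y2 ^ 2) / N, q (ta + tau (x + L / 2))) :: nil).
    destruct (hat x) as [i1 e1]; [lra|]. destruct (hat (x + L / 2)) as [i2 e2]; [lra|].
    pose proof (pow2_ge_0 y1). pose proof (pow2_ge_0 y2).
    pose proof (pow2_ge_0 d1). pose proof (pow2_ge_0 d2).
    split; [|split].
    + constructor; [split|constructor; [split|constructor]]; cbn [fst snd].
      * apply Rdiv_le_0_compat; [apply Rdiv_le_0_compat; lra|easy].
      * exists (ta + tau x). split; easy.
      * apply Rdiv_le_0_compat; [lra|easy].
      * exists (ta + tau (x + L / 2)). split; easy.
    + cbn [fold_right fst snd]. rewrite hD. clearbody N. field. lra.
    + cbn [fold_right fst snd]. rewrite e1, e2. unfold zQ1, zQ2. rewrite !hv.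
      fold y1 y2 d1 d2. unfold padd, pscal. cbn [fst snd].
      rewrite (surjective_pairing O) at 5. clearbody N. f_equal.
      * transitivity (fst O * ((d1 ^ 2 + d2 ^ 2) / w ^ 2 + (y1 ^ 2 + y2 ^ 2)) / N
          + 2 * (y1 * d1 + y2 * d2) * (y1 * d1 - y2 * d2) / w ^ 2 / N); [field; lra|].
        rewrite hz, hD. field. lra.
      * transitivity (snd O * ((d1 ^ 2 + d2 ^ 2) / w ^ 2 + (y1 ^ 2 + y2 ^ 2)) / N
          + 2 * (y1 * d1 + y2 * d2) * (y2 * d1 + y1 * d2) / w ^ 2 / N); [field; lra|].
        rewrite hz, hD. field. lra.
  - exists (tau L).
    assert (hP : tau L < tb - ta).
    { assert (hP : tau L <= tau (s tb)) by auto.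
      destruct (Req_dec L (s tb)) as [e|e].
      (* An arc of exactly one period would end where it starts. Excluding this gives the strict
         inequality that [multi_revolution] demands. *)
      - exfalso. apply hne. destruct (hat 0) as [_ h0]; [lra|]. destruct (hat L) as [_ h1]; [lra|].
        rewrite t0, Rplus_0_r in h0. rewrite e, htb in h1 at 1.
        replace (ta + (tb - ta)) with tb in h1 by ring.
        rewrite h0, h1. destruct (hQ 0) as [q1 q2]. rewrite Rplus_0_l in q1, q2.
        rewrite q1, q2. easy.
      - rewrite <- htb. apply hmono. lra. }
    assert (hPp : 0 < tau L) by (rewrite <- t0; apply hmono; easy).
    split; [easy|]. intros t ht.
    destruct (hl' t ltac:(lra)) as [h1 [h2 h3]].
    destruct (hl' (t + tau L) ltac:(lra)) as [h4 [h5 h6]].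
    assert (e : s (t + tau L) = s t + L).
    { apply (ztau_inj k a1 a2 u1 u2); [easy|].
      unfold L. rewrite ek at 2. rewrite ztau_half_period by easy. rewrite <- ek.
      fold L. fold tau. fold tau in h3, h6. rewrite h3, h6. ring. }
    rewrite e in h4, h5. destruct (hQ (s t)) as [q1 q2]. rewrite q1 in h4. rewrite q2 in h5.
    rewrite (surjective_pairing (q (t + tau L))), (surjective_pairing (q t)). f_equal; lra.
Qed.

(** * Construction of the arcs *)

Definition zr (k a1 a2 u1 u2 s : R) : R := zc k a1 u1 s ^ 2 + zc k a2 u2 s ^ 2.

Definition zv1 (k a1 a2 u1 u2 s : R) : R :=
  2 * (zc k a1 u1 s * zd k a1 u1 s - zc k a2 u2 s * zd k a2 u2 s) / zr k a1 a2 u1 u2 s.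

Definition zv2 (k a1 a2 u1 u2 s : R) : R :=
  2 * (zc k a1 u1 s * zd k a2 u2 s + zc k a2 u2 s * zd k a1 u1 s) / zr k a1 a2 u1 u2 s.

Lemma ztau_clock (k a1 a2 u1 u2 x ta : R) : lc_energy k a1 a2 u1 u2 -> 0 < x ->
  exists s : R -> R, forall t, ta <= t <= ta + ztau k a1 a2 u1 u2 x ->
    ztau k a1 a2 u1 u2 (s t) = t - ta /\ continuity_pt s t /\
    (0 < zr k a1 a2 u1 u2 (s t) -> is_derive s t (1 / zr k a1 a2 u1 u2 (s t))).
Proof.
  intros hE hx. set (tau := ztau k a1 a2 u1 u2).
  assert (hd : forall y, is_derive tau y (zr k a1 a2 u1 u2 y)) by (intros; apply ztau_derive).
  assert (hlt : forall y y', y < y' -> tau y < tau y') by (intros; apply ztau_lt; easy).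
  assert (hle : forall y y', y <= y' -> tau y <= tau y') by (intros; apply ztau_le; easy).
  assert (t0 : tau 0 = 0) by apply ztau_0.
  set (s := fun t => epsilon (inhabits 0) (fun y => tau y = t - ta)).
  assert (hs : forall t, tau (-1) < t - ta < tau (x + 1) -> tau (s t) = t - ta).
  { intros t ht. unfold s. apply epsilon_spec.
    destruct (IVT_interv (fun y => tau y - (t - ta)) (-1) (x + 1)) as [z [_ hz]]; try lra.
    - intros y _. apply (continuity_pt_minus tau (fun _ => t - ta)).
      + eapply is_derive_continuity_pt, hd.
      + now apply continuity_pt_const.
    - exists z. lra. }
  pose proof (hlt (-1) 0 ltac:(lra)). pose proof (hlt x (x + 1) ltac:(lra)).
  set (m := Rmin (ta - (ta + tau (-1))) (tau (x + 1) - tau x)).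
  assert (hm : 0 < m) by (apply Rmin_pos; lra).
  assert (hs' : forall t, ta - m < t < ta + tau x + m -> tau (s t) = t - ta).
  { intros t ht. apply hs.
    pose proof (Rmin_l (ta - (ta + tau (-1))) (tau (x + 1) - tau x)).
    pose proof (Rmin_r (ta - (ta + tau (-1))) (tau (x + 1) - tau x)). fold m in H1, H2. lra. }
  clearbody m s. exists s. intros t ht.
  assert (et : tau (s t) = t - ta) by (apply hs'; lra).
  assert (hc : continuity_pt s t).
  { apply continuity_pt_locally. intros [e he]. simpl.
    pose proof (hlt (s t - e) (s t) ltac:(lra)) as l1.
    pose proof (hlt (s t) (s t + e) ltac:(lra)) as l2.
    set (d := Rmin m (Rmin (tau (s t) - tau (s t - e)) (tau (s t + e) - tau (s t)))).
    assert (hdp : 0 < d) by (apply Rmin_pos; [lra|apply Rmin_pos; lra]).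
    assert (d1 : d <= m) by apply Rmin_l.
    assert (d2 : d <= tau (s t) - tau (s t - e))
      by (eapply Rle_trans; [apply Rmin_r|apply Rmin_l]).
    assert (d3 : d <= tau (s t + e) - tau (s t))
      by (eapply Rle_trans; [apply Rmin_r|apply Rmin_r]).
    exists (mkposreal d hdp). intros y hy.
    apply ball_bounds in hy; simpl in hy.
    assert (ey : tau (s y) = y - ta) by (apply hs'; lra).
    apply Rabs_def1.
    - destruct (Rlt_dec (s y) (s t + e)) as [l|l]; [lra|].
      pose proof (hle (s t + e) (s y) ltac:(lra)). lra.
    - destruct (Rlt_dec (s t - e) (s y)) as [l|l]; [lra|].
      pose proof (hle (s y) (s t - e) ltac:(lra)). lra. }
  split; [easy|]. split; [easy|]. intros hr.
  assert (Prf : forall a, s (t - m / 2) <= a <= s (t + m / 2) -> derivable_pt tau a).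
  { intros a _. eexists. apply is_derive_Reals, hd. }
  assert (hi : s (t - m / 2) <= s t <= s (t + m / 2)).
  { pose proof (hs' (t - m / 2) ltac:(lra)). pose proof (hs' (t + m / 2) ltac:(lra)).
    split.
    - destruct (Rle_dec (s (t - m / 2)) (s t)) as [l|l]; [easy|].
      pose proof (hlt (s t) (s (t - m / 2)) ltac:(lra)). lra.
    - destruct (Rle_dec (s t) (s (t + m / 2))) as [l|l]; [easy|].
      pose proof (hlt (s (t + m / 2)) (s t) ltac:(lra)). lra. }
  assert (hD : derive_pt tau (s t) (Prf (s t) hi) = zr k a1 a2 u1 u2 (s t)).
  { apply derive_pt_eq_0, is_derive_Reals, hd. }
  apply is_derive_Reals. rewrite <- hD.
  (* The library lemma inverts [tau], here shifted so that its argument is [t]. *)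
  set (tau' := fun y => tau y + ta).
  assert (Prf' : forall a, s (t - m / 2) <= a <= s (t + m / 2) -> derivable_pt tau' a).
  { intros a ha. apply (derivable_pt_plus tau (fun _ => ta)); [auto|apply derivable_pt_const]. }
  assert (hD' : derive_pt tau' (s t) (Prf' (s t) hi) = derive_pt tau (s t) (Prf (s t) hi)).
  { rewrite hD. apply derive_pt_eq_0.
    replace (zr k a1 a2 u1 u2 (s t)) with (zr k a1 a2 u1 u2 (s t) + 0) by ring.
    apply (derivable_pt_lim_plus tau (fun _ => ta)).
    - apply is_derive_Reals, hd.
    - apply derivable_pt_lim_const. }
  rewrite <- hD'.
  apply derivable_pt_lim_recip_interv; [easy|lra|lra| |].
  - intros y hy. unfold comp, tau', id. rewrite hs' by lra. ring.
  - rewrite hD', hD. lra.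
Qed.

(** Newton's equation reads [dv/ds = - q / r^2] in Sundman time; the energy relation is what
    normalizes the attraction constant to [1]. *)
Lemma zv1_derive (k a1 a2 u1 u2 s : R) : lc_energy k a1 a2 u1 u2 ->
  0 < zr k a1 a2 u1 u2 s ->
  is_derive (zv1 k a1 a2 u1 u2) s (- zQ1 k a1 a2 u1 u2 s / zr k a1 a2 u1 u2 s ^ 2).
Proof.
  intros hE hr. pose proof (lc_energy_flow _ _ _ _ _ s hE) as h. unfold lc_energy in h.
  unfold zv1, zQ1, zr in *. zderive; [lra|].
  revert hr h. generalize (zc k a1 u1 s) (zc k a2 u2 s) (zd k a1 u1 s) (zd k a2 u2 s).
  intros y1 y2 d1 d2 hr h.
  transitivity (- (y1 ^ 2 - y2 ^ 2) * (2 * (d1 ^ 2 + d2 ^ 2) - 2 * k * (y1 ^ 2 + y2 ^ 2))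
    / (y1 ^ 2 + y2 ^ 2) ^ 2); [field; lra|]. rewrite h. field. lra.
Qed.

Lemma zv2_derive (k a1 a2 u1 u2 s : R) : lc_energy k a1 a2 u1 u2 ->
  0 < zr k a1 a2 u1 u2 s ->
  is_derive (zv2 k a1 a2 u1 u2) s (- zQ2 k a1 a2 u1 u2 s / zr k a1 a2 u1 u2 s ^ 2).
Proof.
  intros hE hr. pose proof (lc_energy_flow _ _ _ _ _ s hE) as h. unfold lc_energy in h.
  unfold zv2, zQ2, zr in *. zderive; [lra|].
  revert hr h. generalize (zc k a1 u1 s) (zc k a2 u2 s) (zd k a1 u1 s) (zd k a2 u2 s).
  intros y1 y2 d1 d2 hr h.
  transitivity (- (2 * y1 * y2) * (2 * (d1 ^ 2 + d2 ^ 2) - 2 * k * (y1 ^ 2 + y2 ^ 2))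
    / (y1 ^ 2 + y2 ^ 2) ^ 2); [field; lra|]. rewrite h. field. lra.
Qed.

Lemma pnorm_zQ (O : pt) (k a1 a2 u1 u2 s : R) :
  pnorm (psub (fst O + zQ1 k a1 a2 u1 u2 s, snd O + zQ2 k a1 a2 u1 u2 s) O)
  = zr k a1 a2 u1 u2 s.
Proof.
  unfold pnorm, psub; cbn [fst snd].
  assert (0 <= zr k a1 a2 u1 u2 s).
  { unfold zr. pose proof (pow2_ge_0 (zc k a1 u1 s)). pose proof (pow2_ge_0 (zc k a2 u2 s)). lra. }
  rewrite <- (sqrt_pow2 (zr k a1 a2 u1 u2 s)) by easy.
  f_equal. unfold zQ1, zQ2, zr. ring.
Qed.

(* The velocity is [dq/dt = 2 z z' / |z|^2]. *)
Definition arc_velocity (q : R -> pt) (s : R -> R) (k a1 a2 u1 u2 ta tb : R) : Prop :=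
  forall t, ta <= t <= tb -> 0 < zr k a1 a2 u1 u2 (s t) ->
    is_derive (fun t => fst (q t)) t (zv1 k a1 a2 u1 u2 (s t)) /\
    is_derive (fun t => snd (q t)) t (zv2 k a1 a2 u1 u2 (s t)).

(** Without angular momentum, [u = c a] with [c] real, so [z] is [a] times the real function
    [zc k 1 c]. Its square keeps the position on the ray of [a^2]: the function passes through [0]
    at a collision, and squaring turns this into a bounce. *)
Lemma collinear_rectilinear (O : pt) (q : R -> pt) (s : R -> R) (k a1 a2 u1 u2 ta tb : R) :
  lc_energy k a1 a2 u1 u2 -> 0 < a1 ^ 2 + a2 ^ 2 -> a1 * u2 - a2 * u1 = 0 ->
  (forall t, q t = (fst O + zQ1 k a1 a2 u1 u2 (s t), snd O + zQ2 k a1 a2 u1 u2 (s t))) ->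
  (forall t, ta <= t <= tb -> continuity_pt s t /\
    (0 < zr k a1 a2 u1 u2 (s t) -> is_derive s t (1 / zr k a1 a2 u1 u2 (s t)))) ->
  (exists Z, forall t, ta <= t <= tb -> zr k a1 a2 u1 u2 (s t) = 0 -> In t Z) ->
  kepler_rectilinear O q ta tb.
Proof.
  intros hE ha hL hq hs [Z hZ].
  set (n := a1 ^ 2 + a2 ^ 2) in *.
  set (c := (a1 * u1 + a2 * u2) / n).
  assert (e1 : u1 = c * a1).
  { unfold c. apply Rmult_eq_reg_r with n; [|lra].
    transitivity (a1 * (a1 * u1 + a2 * u2) - a2 * (a1 * u2 - a2 * u1)); [unfold n; ring|].
    rewrite hL. field. lra. }
  assert (e2 : u2 = c * a2).
  { unfold c. apply Rmult_eq_reg_r with n; [|lra].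
    transitivity (a2 * (a1 * u1 + a2 * u2) + a1 * (a1 * u2 - a2 * u1)); [unfold n; ring|].
    rewrite hL. field. lra. }
  clearbody c. subst u1 u2.
  assert (hz : forall a x, zc k a (c * a) x = a * zc k 1 c x) by (intros; unfold zc; ring).
  assert (hrz : forall x, zr k a1 a2 (c * a1) (c * a2) x = n * zc k 1 c x ^ 2).
  { intros x. unfold zr, n. rewrite !hz. ring. }
  assert (hen : forall x, 2 * n * (zd k 1 c x ^ 2 - k * zc k 1 c x ^ 2) = 1).
  { intros x. pose proof (lc_energy_flow _ _ _ _ _ x hE) as h. unfold lc_energy in h.
    etransitivity; [|exact h]. unfold n, zc, zd. ring. }
  exists ((a1 ^ 2 - a2 ^ 2) / n, 2 * a1 * a2 / n),
    (fun t => n * zc k 1 c (s t) ^ 2),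
    (fun t => 2 * zd k 1 c (s t) / zc k 1 c (s t)), (2 * k), Z.
  split.
  { unfold pnorm; cbn [fst snd].
    replace (((a1 ^ 2 - a2 ^ 2) / n) ^ 2 + (2 * a1 * a2 / n) ^ 2) with 1; [apply sqrt_1|].
    transitivity (n ^ 2 / n ^ 2); [field; lra|]. unfold n at 1. field. lra. }
  intros t ht. destruct (hs t ht) as [cs ds]. rewrite hrz in ds.
  split; [|split; [|split; [|split]]].
  - rewrite hq. unfold padd, pscal, zQ1, zQ2; cbn [fst snd]. rewrite !hz.
    f_equal; field; lra.
  - pose proof (pow2_ge_0 (zc k 1 c (s t))). nra.
  - apply (continuity_pt_comp s (fun x => n * zc k 1 c x ^ 2)); [easy|].
    eapply is_derive_continuity_pt. zderive. reflexivity.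
  - intros h. apply hZ; [easy|]. rewrite hrz. easy.
  - intros hp. specialize (ds hp).
    assert (hne : zc k 1 c (s t) <> 0).
    { intros h0. rewrite h0 in hp. lra. }
    specialize (hen (s t)).
    split; [|split].
    + apply is_derive_Reals.
      replace (2 * zd k 1 c (s t) / zc k 1 c (s t))
        with (n * (2 * zc k 1 c (s t) * zd k 1 c (s t)) * (1 / (n * zc k 1 c (s t) ^ 2)))
        by (field; lra).
      apply (is_derive_compose (fun x => n * zc k 1 c x ^ 2) s); [|easy].
      zderive. ring.
    + apply is_derive_Reals.
      replace (- 1 / (n * zc k 1 c (s t) ^ 2) ^ 2)
        with (- 1 / (n * zc k 1 c (s t) ^ 2) * (1 / (n * zc k 1 c (s t) ^ 2))) by (field; lra).
      apply (is_derive_compose (fun x => 2 * zd k 1 c x / zc k 1 c x) s); [|easy].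
      zderive; [easy|].
      transitivity (- (2 * n * (zd k 1 c (s t) ^ 2 - k * zc k 1 c (s t) ^ 2))
        / (n * zc k 1 c (s t) ^ 2)); [field; lra|].
      rewrite hen. easy.
    + transitivity ((2 * n * zd k 1 c (s t) ^ 2
        - 2 * n * (zd k 1 c (s t) ^ 2 - k * zc k 1 c (s t) ^ 2)) / (n * zc k 1 c (s t) ^ 2)).
      * rewrite hen. field. lra.
      * field. lra.
Qed.

Lemma orbit_arc (O : pt) (k a1 a2 u1 u2 x ta : R) :
  lc_energy k a1 a2 u1 u2 -> early k x -> 0 < a1 ^ 2 + a2 ^ 2 ->
  let tb := ta + ztau k a1 a2 u1 u2 x in
  exists q s, arc_lift O q s k a1 a2 u1 u2 ta tb /\ s tb = x /\
    arc_velocity q s k a1 a2 u1 u2 ta tb /\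
    (kepler_regular O q ta tb \/ kepler_rectilinear O q ta tb).
Proof.
  intros hE hx ha tb.
  destruct (ztau_clock k a1 a2 u1 u2 x ta hE (proj1 hx)) as [s hs]. fold tb in hs.
  set (q := fun t => (fst O + zQ1 k a1 a2 u1 u2 (s t), snd O + zQ2 k a1 a2 u1 u2 (s t))).
  assert (htb : ta < tb).
  { pose proof (ztau_lt k a1 a2 u1 u2 0 x hE (proj1 hx)) as h. rewrite ztau_0 in h.
    unfold tb. lra. }
  assert (hlt : forall y y', ztau k a1 a2 u1 u2 y <= ztau k a1 a2 u1 u2 y' -> y <= y').
  { intros y y' h. destruct (Rle_dec y y') as [l|l]; [easy|].
    pose proof (ztau_lt k a1 a2 u1 u2 y' y hE ltac:(lra)). lra. }
  assert (sb : s tb = x).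
  { apply (ztau_inj k a1 a2 u1 u2); [easy|]. rewrite (proj1 (hs tb ltac:(lra))). unfold tb. ring. }
  assert (sa : s ta = 0).
  { apply (ztau_inj k a1 a2 u1 u2); [easy|]. rewrite (proj1 (hs ta ltac:(lra))), ztau_0. ring. }
  assert (hI : forall t, ta <= t <= tb -> 0 <= s t <= x).
  { intros t ht. destruct (hs t ht) as [e _]. split; apply hlt; rewrite e.
    - rewrite ztau_0. lra.
    - unfold tb in ht. lra. }
  assert (hv : arc_velocity q s k a1 a2 u1 u2 ta tb).
  { intros t ht hr. destruct (hs t ht) as [_ [_ ds]]. specialize (ds hr).
    split; unfold q; cbn [fst snd].
    - replace (zv1 k a1 a2 u1 u2 (s t))
        with (2 * (zc k a1 u1 (s t) * zd k a1 u1 (s t) - zc k a2 u2 (s t) * zd k a2 u2 (s t))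
          * (1 / zr k a1 a2 u1 u2 (s t))) by (unfold zv1; field; lra).
      apply (is_derive_compose (fun y => fst O + zQ1 k a1 a2 u1 u2 y) s); [|easy].
      unfold zQ1. zderive. ring.
    - replace (zv2 k a1 a2 u1 u2 (s t))
        with (2 * (zc k a1 u1 (s t) * zd k a2 u2 (s t) + zc k a2 u2 (s t) * zd k a1 u1 (s t))
          * (1 / zr k a1 a2 u1 u2 (s t))) by (unfold zv2; field; lra).
      apply (is_derive_compose (fun y => snd O + zQ2 k a1 a2 u1 u2 y) s); [|easy].
      unfold zQ2. zderive. ring. }
  exists q, s. split; [|split; [easy|split; [easy|]]].
  { split; [easy|]. split; [easy|]. intros t ht. unfold q; cbn [fst snd].
    split; [ring|]. split; [ring|]. apply hs. easy. }
  (* This Wronskian is conserved and proportional to the angular momentum; when it is not zero, [z]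
     cannot vanish and the motion is regular. *)
  destruct (Req_dec (a1 * u2 - a2 * u1) 0) as [hL|hL]; [right|left].
  - apply (collinear_rectilinear O q s k a1 a2 u1 u2); try easy.
    { intros t ht. apply (hs t ht). }
    (* If [z] vanishes at [s t], it equals [z' S] later on, and [S] is positive over the remaining
       range because [x] is early. So there is at most one collision, which yields the finite
       list. *)
    assert (huniq : forall t t', ta <= t <= tb -> ta <= t' <= tb -> t < t' ->
      zr k a1 a2 u1 u2 (s t) = 0 -> zr k a1 a2 u1 u2 (s t') = 0 -> False).
    { intros t t' ht ht' hlt' z z'.
      apply sum_squares_zero in z, z'. destruct z as [z1 z2], z' as [z1' z2'].
      assert (hss : s t < s t').
      { destruct (Rlt_dec (s t) (s t')) as [l|l]; [easy|].
        pose proof (ztau_le k a1 a2 u1 u2 (s t') (s t) ltac:(lra)) as h.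
        rewrite (proj1 (hs t ht)), (proj1 (hs t' ht')) in h. lra. }
      replace (s t') with (s t + (s t' - s t)) in z1', z2' by ring.
      rewrite zc_plus, z1 in z1'. rewrite zc_plus, z2 in z2'.
      assert (hS : 0 < kS k (s t' - s t)).
      { apply hx. pose proof (hI t ht). pose proof (hI t' ht'). lra. }
      pose proof (lc_energy_flow _ _ _ _ _ (s t) hE) as h. unfold lc_energy in h.
      rewrite z1, z2 in h.
      assert (zd k a1 u1 (s t) = 0) as d1 by nra. assert (zd k a2 u2 (s t) = 0) as d2 by nra.
      rewrite d1, d2 in h. lra. }
    destruct (classic (exists t, ta <= t <= tb /\ zr k a1 a2 u1 u2 (s t) = 0))
      as [[t [ht hz]]|hno].
    + exists (t :: nil). intros t' ht' hz'. left.
      destruct (Rtotal_order t t') as [l|[l|l]]; [|easy|]; exfalso.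
      * apply (huniq t t'); easy.
      * apply (huniq t' t); easy.
    + exists nil. intros t ht hz. apply hno. exists t. easy.
  - exists (fun t => (zv1 k a1 a2 u1 u2 (s t), zv2 k a1 a2 u1 u2 (s t))).
    intros t ht.
    assert (hr : 0 < zr k a1 a2 u1 u2 (s t)).
    { assert (hLs : zc k a1 u1 (s t) * zd k a2 u2 (s t) - zc k a2 u2 (s t) * zd k a1 u1 (s t)
        = a1 * u2 - a2 * u1).
      { transitivity ((a1 * u2 - a2 * u1) * (kC k (s t) ^ 2 - k * kS k (s t) ^ 2));
          [unfold zc, zd; ring|]. rewrite kCS_unit. ring. }
      unfold zr. pose proof (pow2_ge_0 (zc k a1 u1 (s t))).
      pose proof (pow2_ge_0 (zc k a2 u2 (s t))).
      destruct (Req_dec (zc k a1 u1 (s t) ^ 2 + zc k a2 u2 (s t) ^ 2) 0) as [e|e]; [|lra].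
      apply sum_squares_zero in e. destruct e as [e e']. rewrite e, e' in hLs. lra. }
    destruct (hs t ht) as [_ [_ ds]]. specialize (ds hr).
    destruct (hv t ht hr) as [v1 v2].
    split.
    { intros e. pose proof (pnorm_zQ O k a1 a2 u1 u2 (s t)) as hp. fold (q t) in hp.
      rewrite e in hp. unfold pnorm, psub in hp; cbn [fst snd] in hp.
      rewrite !Rminus_diag in hp. replace (0 ^ 2 + 0 ^ 2) with 0 in hp by ring.
      rewrite sqrt_0 in hp. lra. }
    assert (hp : pnorm (psub (q t) O) = zr k a1 a2 u1 u2 (s t)) by apply pnorm_zQ.
    rewrite hp. cbn [fst snd].
    split; [now apply is_derive_Reals|]. split; [now apply is_derive_Reals|].
    split; apply is_derive_Reals.
    + replace (- (fst (q t) - fst O) / zr k a1 a2 u1 u2 (s t) ^ 3)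
        with (- zQ1 k a1 a2 u1 u2 (s t) / zr k a1 a2 u1 u2 (s t) ^ 2
          * (1 / zr k a1 a2 u1 u2 (s t))) by (unfold q; cbn [fst snd]; field; lra).
      apply is_derive_compose; [apply zv1_derive; easy|easy].
    + replace (- (snd (q t) - snd O) / zr k a1 a2 u1 u2 (s t) ^ 3)
        with (- zQ2 k a1 a2 u1 u2 (s t) / zr k a1 a2 u1 u2 (s t) ^ 2
          * (1 / zr k a1 a2 u1 u2 (s t))) by (unfold q; cbn [fst snd]; field; lra).
      apply is_derive_compose; [apply zv2_derive; easy|easy].
Qed.

(** Arcs are compared on a closed interval only, while their derivatives are two-sided; right
    difference quotients settle the left endpoint. *)
Lemma derive_unique_right (f g : R -> R) (x b l l' : R) : x < b ->
  is_derive f x l -> is_derive g x l' -> (forall t, x <= t <= b -> f t = g t) -> l = l'.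
Proof.
  intros hb hf hg heq.
  assert (h : is_derive (fun t => f t - g t) x (l - l')) by (apply (is_derive_minus f g); easy).
  apply is_derive_Reals in h.
  destruct (Req_dec l l') as [e|e]; [easy|exfalso].
  assert (hp : 0 < Rabs (l - l')) by (apply Rabs_pos_lt; lra).
  destruct (h _ hp) as [[d hd] H]. simpl in H.
  set (y := Rmin (d / 2) (b - x)).
  assert (hy : 0 < y) by (apply Rmin_pos; lra).
  assert (y <= d / 2) by apply Rmin_l. assert (y <= b - x) by apply Rmin_r.
  specialize (H y ltac:(lra)). rewrite Rabs_right in H by lra. specialize (H ltac:(lra)).
  rewrite (heq (x + y)), (heq x) in H by lra.
  replace ((g (x + y) - g (x + y) - (g x - g x)) / y - (l - l')) with (- (l - l')) in H
    by (field; lra).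
  rewrite Rabs_Ropp in H. lra.
Qed.

Lemma double_quotient_inj (n X Y : R) : 0 < n -> 2 * X / n = 2 * Y / n -> X = Y.
Proof.
  intros hn h. apply Rmult_eq_reg_r with (2 / n).
  - transitivity (2 * X / n); [field; lra|]. rewrite h. field. lra.
  - apply Rgt_not_eq. apply Rdiv_lt_0_compat; lra.
Qed.

(** The hypotheses make [(a, u)] an eigenvector of the linear flow with eigenvalue [e]. Pairing with
    the energy form gives [e = C]; then [S <> 0] forces [u = 0] and [k a = 0], and the energy
    relation fails. *)
Lemma early_orbit_not_periodic (k a1 a2 u1 u2 x e : R) :
  lc_energy k a1 a2 u1 u2 -> 0 < kS k x ->
  zc k a1 u1 x = e * a1 -> zc k a2 u2 x = e * a2 ->
  zd k a1 u1 x = e * u1 -> zd k a2 u2 x = e * u2 -> False.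
Proof.
  intros hE hS h1 h2 h3 h4. unfold lc_energy in hE. unfold zc, zd in *.
  assert (e1 : (e - kC k x) * a1 = kS k x * u1) by lra.
  assert (e2 : (e - kC k x) * a2 = kS k x * u2) by lra.
  assert (e3 : (e - kC k x) * u1 = kS k x * (k * a1)) by lra.
  assert (e4 : (e - kC k x) * u2 = kS k x * (k * a2)) by lra.
  assert (h0 : e - kC k x = 0).
  { assert ((e - kC k x) * (2 * (u1 ^ 2 + u2 ^ 2) - 2 * k * (a1 ^ 2 + a2 ^ 2)) = 0).
    { transitivity (2 * (((e - kC k x) * u1) * u1 + ((e - kC k x) * u2) * u2)
        - 2 * k * (((e - kC k x) * a1) * a1 + ((e - kC k x) * a2) * a2)); [ring|].
      rewrite e1, e2, e3, e4. ring. }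
    rewrite hE in H. lra. }
  rewrite h0 in e1, e2, e3, e4.
  assert (z1 : u1 = 0) by nra. assert (z2 : u2 = 0) by nra.
  assert (z3 : k * a1 = 0) by nra. assert (z4 : k * a2 = 0) by nra.
  rewrite z1, z2 in hE.
  replace (2 * k * (a1 ^ 2 + a2 ^ 2)) with (2 * (k * a1 * a1 + k * a2 * a2)) in hE by ring.
  rewrite z3, z4 in hE. lra.
Qed.

(** A period of [q] brings [z] back to [a] up to sign and, by comparing velocities at [ta] and
    [ta + P], brings [z'] back to [u] up to the same sign. This is impossible before the first zero
    of [S]. *)
Lemma orbit_arc_simple (O : pt) (q : R -> pt) (s : R -> R) (k a1 a2 u1 u2 ta tb : R) :
  ta < tb -> 0 < a1 ^ 2 + a2 ^ 2 -> early k (s tb) ->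
  arc_lift O q s k a1 a2 u1 u2 ta tb -> arc_velocity q s k a1 a2 u1 u2 ta tb ->
  simple_arc O q ta tb.
Proof.
  intros hab ha hx [hE [sa hl]] hv [_ [P [hP hper]]].
  assert (hta : ta <= ta <= tb) by lra.
  assert (htP : ta <= ta + P <= tb) by lra.
  destruct (hl ta hta) as [l1 [l2 l3]]. destruct (hl (ta + P) htP) as [m1 [m2 m3]].
  destruct (hl tb ltac:(lra)) as [_ [_ n3]].
  rewrite hper in m1, m2 by lra. rewrite l1 in m1. rewrite l2 in m2. rewrite sa in m1, m2.
  set (y := s (ta + P)) in *.
  assert (hy : 0 < kS k y).
  { apply hx. split.
    - destruct (Rlt_dec 0 y) as [l|l]; [easy|].
      pose proof (ztau_le k a1 a2 u1 u2 y 0 ltac:(lra)) as h. rewrite ztau_0 in h. lra.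
    - destruct (Rle_dec y (s tb)) as [l|l]; [easy|].
      pose proof (ztau_lt k a1 a2 u1 u2 (s tb) y hE ltac:(lra)). lra. }
  unfold zQ1, zQ2 in m1, m2. rewrite !zc_0 in m1, m2.
  assert (hz : exists e, (e = 1 \/ e = -1) /\ zc k a1 u1 y = e * a1 /\ zc k a2 u2 y = e * a2).
  { destruct (complex_square_inj (zc k a1 u1 y) (zc k a2 u2 y) a1 a2) as [[i1 i2]|[i1 i2]]; try lra.
    - exists 1. split; [now left|]. lra.
    - exists (-1). split; [now right|]. lra. }
  destruct hz as [e [he [z1 z2]]].
  assert (e2 : e * e = 1) by (destruct he as [->| ->]; ring).
  assert (hr0 : zr k a1 a2 u1 u2 (s ta) = a1 ^ 2 + a2 ^ 2).
  { rewrite sa. unfold zr. rewrite !zc_0. easy. }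
  assert (hr1 : zr k a1 a2 u1 u2 y = a1 ^ 2 + a2 ^ 2).
  { unfold zr. rewrite z1, z2.
    transitivity (e * e * (a1 ^ 2 + a2 ^ 2)); [ring|]. rewrite e2. ring. }
  destruct (hv ta hta) as [v1 v2]; [lra|].
  destruct (hv (ta + P) htP) as [w1 w2]; [fold y; lra|]. fold y in w1, w2.
  assert (hshift : forall (f : R -> R) l, is_derive f (ta + P) l -> is_derive (fun t => f (t + P)) ta l).
  { intros f l hf. replace l with (l * (1 + 0)) by ring.
    apply (is_derive_compose f (fun t => t + P)); [easy|].
    apply (is_derive_plus (fun t => t) (fun _ => P)); [apply (is_derive_id ta)|apply (is_derive_const P)]. }
  apply hshift in w1, w2.
  assert (q1 : zv1 k a1 a2 u1 u2 y = zv1 k a1 a2 u1 u2 (s ta)).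
  { apply (derive_unique_right _ _ ta (tb - P) _ _ ltac:(lra) w1 v1).
    intros t ht. rewrite hper by lra. easy. }
  assert (q2 : zv2 k a1 a2 u1 u2 y = zv2 k a1 a2 u1 u2 (s ta)).
  { apply (derive_unique_right _ _ ta (tb - P) _ _ ltac:(lra) w2 v2).
    intros t ht. rewrite hper by lra. easy. }
  unfold zv1, zv2 in q1, q2. rewrite hr0, hr1 in q1, q2.
  rewrite sa, !zc_0, !zd_0, z1, z2 in q1, q2.
  apply double_quotient_inj in q1, q2; [|easy|easy].
  destruct (complex_mul_cancel a1 a2 (e * zd k a1 u1 y) (e * zd k a2 u2 y) u1 u2 ha) as [d1 d2];
    [lra|lra|].
  apply (early_orbit_not_periodic k a1 a2 u1 u2 y e hE hy z1 z2).
  - transitivity (e * (e * zd k a1 u1 y)); [rewrite <- Rmult_assoc, e2; ring|now rewrite d1].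
  - transitivity (e * (e * zd k a2 u2 y)); [rewrite <- Rmult_assoc, e2; ring|now rewrite d2].
Qed.

(** * Identification of arcs through their lifts, and the count *)

Lemma arc_lift_same (O : pt) (q q' : R -> pt) (s s' : R -> R) (k a1 a2 u1 u2 ta tb : R) :
  arc_lift O q s k a1 a2 u1 u2 ta tb -> arc_lift O q' s' k a1 a2 u1 u2 ta tb ->
  same_arc q q' ta tb.
Proof.
  intros [hE [_ h]] [_ [_ h']] t ht.
  destruct (h t ht) as [h1 [h2 h3]]. destruct (h' t ht) as [h1' [h2' h3']].
  assert (e : s t = s' t) by (apply (ztau_inj k a1 a2 u1 u2); [easy|lra]).
  rewrite e in h1, h2.
  rewrite (surjective_pairing (q t)), (surjective_pairing (q' t)). f_equal; lra.
Qed.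

(** For [a] nonzero the initial velocity determines [u], and the energy relation then determines
    [k]. *)
Lemma arc_velocity_initial (O : pt) (q q' : R -> pt) (s s' : R -> R)
  (k k' a1 a2 u1 u2 u1' u2' ta tb : R) :
  ta < tb -> 0 < a1 ^ 2 + a2 ^ 2 ->
  arc_lift O q s k a1 a2 u1 u2 ta tb -> arc_velocity q s k a1 a2 u1 u2 ta tb ->
  arc_lift O q' s' k' a1 a2 u1' u2' ta tb -> arc_velocity q' s' k' a1 a2 u1' u2' ta tb ->
  same_arc q q' ta tb -> k = k' /\ u1 = u1' /\ u2 = u2'.
Proof.
  intros hab ha [hE [s0 _]] hv [hE' [s0' _]] hv' heq.
  assert (hr : forall k u1 u2, zr k a1 a2 u1 u2 0 = a1 ^ 2 + a2 ^ 2)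
    by (intros; unfold zr; rewrite !zc_0; easy).
  destruct (hv ta) as [v1 v2]; [lra|rewrite s0, hr; easy|].
  destruct (hv' ta) as [w1 w2]; [lra|rewrite s0', hr; easy|].
  rewrite s0 in v1, v2. rewrite s0' in w1, w2.
  assert (q1 : zv1 k a1 a2 u1 u2 0 = zv1 k' a1 a2 u1' u2' 0).
  { apply (derive_unique_right _ _ ta tb _ _ hab v1 w1). intros t ht. rewrite heq; easy. }
  assert (q2 : zv2 k a1 a2 u1 u2 0 = zv2 k' a1 a2 u1' u2' 0).
  { apply (derive_unique_right _ _ ta tb _ _ hab v2 w2). intros t ht. rewrite heq; easy. }
  unfold zv1, zv2 in q1, q2. rewrite !hr, !zc_0, !zd_0 in q1, q2.
  apply double_quotient_inj in q1, q2; [|easy|easy].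
  destruct (complex_mul_cancel a1 a2 u1 u2 u1' u2' ha) as [<- <-]; [lra|lra|].
  unfold lc_energy in *. split; [|easy].
  apply Rmult_eq_reg_r with (a1 ^ 2 + a2 ^ 2); lra.
Qed.

Lemma lifted_arc_exists (O A B : pt) (a1 a2 b1 b2 ta T : R) :
  0 < T -> 0 < a1 ^ 2 + a2 ^ 2 ->
  fst A - fst O = a1 ^ 2 - a2 ^ 2 -> snd A - snd O = 2 * a1 * a2 ->
  fst B - fst O = b1 ^ 2 - b2 ^ 2 -> snd B - snd O = 2 * b1 * b2 ->
  - (a1 ^ 2 + a2 ^ 2 + (b1 ^ 2 + b2 ^ 2)) < 2 * (a1 * b1 + a2 * b2)
    < a1 ^ 2 + a2 ^ 2 + (b1 ^ 2 + b2 ^ 2) ->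
  exists q s k u1 u2, simple_kepler_arc O A B q ta (ta + T) /\
    arc_lift O q s k a1 a2 u1 u2 ta (ta + T) /\ arc_velocity q s k a1 a2 u1 u2 ta (ta + T) /\
    early k (s (ta + T)) /\ zc k a1 u1 (s (ta + T)) = b1 /\ zc k a2 u2 (s (ta + T)) = b2.
Proof.
  intros hT ha A1 A2 B1 B2 hp.
  destruct (lambert_exists _ _ T hp hT) as [k [x hl]].
  destruct (orbit_of_lambert k a1 a2 b1 b2 x T hl) as [u1 [u2 [hE [e1 [e2 e3]]]]].
  destruct (orbit_arc O k a1 a2 u1 u2 x ta hE (proj1 hl) ha) as [q [s [h1 [h2 [h3 h4]]]]].
  rewrite e3 in *. exists q, s, k, u1, u2.
  assert (hab : ta < ta + T) by lra.
  assert (hend : q ta = A /\ q (ta + T) = B).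
  { destruct h1 as [_ [s0 hl']].
    destruct (hl' ta ltac:(lra)) as [i1 [i2 _]].
    destruct (hl' (ta + T) ltac:(lra)) as [j1 [j2 _]].
    unfold zQ1, zQ2 in *. rewrite s0, !zc_0 in i1, i2. rewrite h2, e1, e2 in j1, j2.
    rewrite (surjective_pairing (q ta)), (surjective_pairing (q (ta + T))),
      (surjective_pairing A), (surjective_pairing B).
    split; f_equal; lra. }
  split.
  - split.
    + split; [easy|]. split; [easy|]. split; easy.
    + apply (orbit_arc_simple O q s k a1 a2 u1 u2); try easy. rewrite h2. apply hl.
  - rewrite h2. split; [easy|]. split; [easy|]. split; [apply hl|easy].
Qed.

Lemma simple_arc_lift (O A B : pt) (q : R -> pt) (a1 a2 ta tb : R) :
  O <> A -> O <> B -> A <> B ->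
  fst A - fst O = a1 ^ 2 - a2 ^ 2 -> snd A - snd O = 2 * a1 * a2 ->
  simple_kepler_arc O A B q ta tb ->
  exists s k u1 u2, arc_lift O q s k a1 a2 u1 u2 ta tb /\ early k (s tb).
Proof.
  intros hOA hOB hAB A1 A2 [[hab [qa [qb hq]]] hs].
  assert (hl : exists s k u1 u2, arc_lift O q s k a1 a2 u1 u2 ta tb).
  { destruct hq as [hq|hq].
    - apply kepler_regular_arc_lift; try easy; rewrite qa; easy.
    - apply kepler_rectilinear_arc_lift; rewrite ?qa, ?qb; auto. }
  destruct hl as [s [k [u1 [u2 hl]]]]. exists s, k, u1, u2. split; [easy|].
  apply (simple_arc_early O q s k a1 a2 u1 u2 ta tb); try easy. rewrite qa, qb. easy.
Qed.

(** The elapsed time and the end lift [b] determine [k] and the Sundman length by [lambert_unique],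
    hence [u], hence the whole motion. *)
Lemma lifted_arc_unique (O : pt) (q q' : R -> pt) (s s' : R -> R)
  (k k' a1 a2 u1 u2 u1' u2' b1 b2 ta tb : R) :
  ta < tb ->
  - (a1 ^ 2 + a2 ^ 2 + (b1 ^ 2 + b2 ^ 2)) < 2 * (a1 * b1 + a2 * b2)
    < a1 ^ 2 + a2 ^ 2 + (b1 ^ 2 + b2 ^ 2) ->
  arc_lift O q s k a1 a2 u1 u2 ta tb -> early k (s tb) ->
  zc k a1 u1 (s tb) = b1 -> zc k a2 u2 (s tb) = b2 ->
  arc_lift O q' s' k' a1 a2 u1' u2' ta tb -> early k' (s' tb) ->
  zc k' a1 u1' (s' tb) = b1 -> zc k' a2 u2' (s' tb) = b2 ->
  same_arc q q' ta tb.
Proof.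
  intros hab hp h hx e1 e2 h' hx' e1' e2'.
  pose proof (lambert_of_orbit k a1 a2 u1 u2 (s tb) (proj1 h) hx) as L.
  pose proof (lambert_of_orbit k' a1 a2 u1' u2' (s' tb) (proj1 h') hx') as L'.
  rewrite e1, e2 in L. rewrite e1', e2' in L'.
  assert (t1 : ztau k a1 a2 u1 u2 (s tb) = tb - ta) by (apply h; lra).
  assert (t2 : ztau k' a1 a2 u1' u2' (s' tb) = tb - ta) by (apply h'; lra).
  rewrite t1 in L. rewrite t2 in L'.
  destruct (lambert_unique _ _ _ _ _ _ _ hp L L') as [<- es].
  rewrite <- es in e1', e2'.
  assert (u1 = u1') as <- by (apply (zc_initial_velocity k a1 u1 u1' (s tb)); [easy|congruence]).
  assert (u2 = u2') as <- by (apply (zc_initial_velocity k a2 u2 u2' (s tb)); [easy|congruence]).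
  apply (arc_lift_same O q q' s s' k a1 a2 u1 u2); easy.
Qed.

Theorem mainTheorem10 (O A B : pt) (hOA : O <> A) (hOB : O <> B) (hAB : A <> B)
  (T : R) (hT : 0 < T) (tA : R) :
  exists q1 q2 : R -> pt,
    simple_kepler_arc O A B q1 tA (tA + T) /\
    simple_kepler_arc O A B q2 tA (tA + T) /\
    ~ same_arc q1 q2 tA (tA + T) /\
    forall q, simple_kepler_arc O A B q tA (tA + T) ->
      same_arc q q1 tA (tA + T) \/ same_arc q q2 tA (tA + T).
Proof.
  destruct (complex_sqrt (fst A - fst O) (snd A - snd O)) as [a1 [a2 [A1 A2]]].
  destruct (complex_sqrt (fst B - fst O) (snd B - snd O)) as [b1 [b2 [B1 B2]]].
  assert (hne : forall (P : pt) c1 c2, O <> P ->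
    fst P - fst O = c1 ^ 2 - c2 ^ 2 -> snd P - snd O = 2 * c1 * c2 -> 0 < c1 ^ 2 + c2 ^ 2).
  { intros P c1 c2 hP h1 h2.
    pose proof (pow2_ge_0 c1). pose proof (pow2_ge_0 c2).
    destruct (Req_dec (c1 ^ 2 + c2 ^ 2) 0) as [e|e]; [|lra]. exfalso. apply hP.
    apply sum_squares_zero in e. destruct e as [-> ->].
    rewrite (surjective_pairing O), (surjective_pairing P). f_equal; lra. }
  pose proof (hne A a1 a2 hOA A1 A2) as ha. pose proof (hne B b1 b2 hOB B1 B2) as hb.
  assert (hab : forall e, e = 1 \/ e = -1 -> 0 < (a1 - e * b1) ^ 2 + (a2 - e * b2) ^ 2).
  { intros e he.
    pose proof (pow2_ge_0 (a1 - e * b1)). pose proof (pow2_ge_0 (a2 - e * b2)).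
    destruct (Req_dec ((a1 - e * b1) ^ 2 + (a2 - e * b2) ^ 2) 0) as [z|z]; [|lra].
    exfalso. apply hAB. apply sum_squares_zero in z.
    assert (e2 : e * e = 1) by (destruct he as [->| ->]; ring).
    assert (z1 : a1 = e * b1) by lra. assert (z2 : a2 = e * b2) by lra.
    rewrite z1, z2 in A1, A2.
    replace ((e * b1) ^ 2 - (e * b2) ^ 2) with (e * e * (b1 ^ 2 - b2 ^ 2)) in A1 by ring.
    replace (2 * (e * b1) * (e * b2)) with (e * e * (2 * b1 * b2)) in A2 by ring.
    rewrite e2 in A1, A2.
    rewrite (surjective_pairing A), (surjective_pairing B). f_equal; lra. }
  pose proof (hab 1 ltac:(now left)) as h1. pose proof (hab (-1) ltac:(now right)) as h2.
  assert (p1 : - (a1 ^ 2 + a2 ^ 2 + (b1 ^ 2 + b2 ^ 2)) < 2 * (a1 * b1 + a2 * b2)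
    < a1 ^ 2 + a2 ^ 2 + (b1 ^ 2 + b2 ^ 2)) by lra.
  assert (p2 : - (a1 ^ 2 + a2 ^ 2 + ((- b1) ^ 2 + (- b2) ^ 2)) < 2 * (a1 * - b1 + a2 * - b2)
    < a1 ^ 2 + a2 ^ 2 + ((- b1) ^ 2 + (- b2) ^ 2)) by lra.
  assert (htb : tA < tA + T) by lra.
  destruct (lifted_arc_exists O A B a1 a2 b1 b2 tA T hT ha A1 A2 B1 B2 p1)
    as [q1 [s1 [k1 [u1 [w1 [arc1 [l1 [v1 [x1 [e1 f1]]]]]]]]]].
  destruct (lifted_arc_exists O A B a1 a2 (- b1) (- b2) tA T hT ha A1 A2
    ltac:(lra) ltac:(lra) p2) as [q2 [s2 [k2 [u2 [w2 [arc2 [l2 [v2 [x2 [e2 f2]]]]]]]]]].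
  exists q1, q2. split; [easy|]. split; [easy|]. split.
  (* Equal arcs would share [k], the initial data and the final Sundman time, so their end lifts [b]
     and [- b] would coincide, contrary to [O <> B]. *)
  - intros heq.
    destruct (arc_velocity_initial O q1 q2 s1 s2 k1 k2 a1 a2 u1 w1 u2 w2 tA (tA + T)
      htb ha l1 v1 l2 v2 heq) as [<- [<- <-]].
    assert (es : s1 (tA + T) = s2 (tA + T)).
    { apply (ztau_inj k1 a1 a2 u1 w1); [apply l1|].
      transitivity (tA + T - tA); [|symmetry]; [apply l1; lra|apply l2; lra]. }
    rewrite <- es in e2, f2. rewrite e1 in e2. rewrite f1 in f2.
    assert (b1 = 0) as z1 by lra. assert (b2 = 0) as z2 by lra. rewrite z1, z2 in hb. lra.
  - intros q hq.
    destruct (simple_arc_lift O A B q a1 a2 tA (tA + T) hOA hOB hAB A1 A2 hq)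
      as [s [k [u [w [l x]]]]].
    assert (hB : q (tA + T) = B) by apply hq.
    pose proof l as [_ [_ hl]]. destruct (hl (tA + T) ltac:(lra)) as [i1 [i2 _]].
    rewrite hB in i1, i2. unfold zQ1, zQ2 in i1, i2.
    (* The end lift of the given arc is a square root of [B - O]; which of the two it is decides
       between [q1] and [q2]. *)
    destruct (complex_square_inj (zc k a1 u (s (tA + T))) (zc k a2 w (s (tA + T))) b1 b2)
      as [[j1 j2]|[j1 j2]]; [lra|lra|left|right].
    + apply (lifted_arc_unique O q q1 s s1 k k1 a1 a2 u w u1 w1 b1 b2); easy.
    + apply (lifted_arc_unique O q q2 s s2 k k2 a1 a2 u w u2 w2 (- b1) (- b2)); easy.
Qed.
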